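(* Let $V$ be Thompson's group $V$. Each of the following is true: (1) For every finite simple graph $\Gamma$, the graph group $G(\Gamma)$ embeds into $V$ if and only if $\Gamma$ is in the class $\mathcal{GP}$. (2) A graph group embeds into $V$ if and only if it is (isomorphic to) a direct product of finitely many finitely generated free groups. (3) $\mathbb{Z}^2*\mathbb{Z}$ is the only obstruction to a graph group embedding into $V$: a graph group embeds into $V$ if and only if it has no subgroup isomorphic to $\mathbb{Z}^2*\mathbb{Z}$.
   Context: A finite simple graph $\Gamma$ consists of a finite set $V(\Gamma)$ of vertices and a set $E(\Gamma)$ of (undirected) edges, with no loops and no multiple edges. The eccentricity $\epsilon(v)$ of a vertex $v$ is the greatest geodesic distance between $v$ and any other vertex of $\Gamma$ (vertices in different connected components are at infinite distance). In particular, $\epsilon(v)=1$ exactly when $\Gamma$ has at least one vertex other than $v$ and $v$ is adjacent to every other vertex. $\mathcal{GP}$ is the class of all finite simple graphs $\Gamma$ for which there exists a partition $P_0,P_1,\dots,P_n$ (for some $n\ge 0$) of $V(\Gamma)$, with all parts except perhaps $P_0$ nonempty, such that: (i) $P_0$ is the set of all vertices of $\Gamma$ with eccentricity one; (ii) if $v_i,v_j\in P_k$ with $k>0$, then $(v_i,v_j)\notin E(\Gamma)$; (iii) if $v_i\in P_i$ and $v_j\in P_j$ with $i\neq j$, then $(v_i,v_j)\in E(\Gamma)$. Such a partition is called a commuting partition. For a finite simple graph $\Gamma$, the graph group (right-angled Artin group) $G(\Gamma)$ is the group with one generator $x_v$ for each vertex $v$ of $\Gamma$ and defining relations $x_ux_v=x_vx_u$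 for each edge $(u,v)\in E(\Gamma)$, and no other relations. A graph group is a group of the form $G(\Gamma)$ for some finite simple graph $\Gamma$. Thompson's group $V$ is the group of homeomorphisms of the Cantor set $\{0,1\}^{\mathbb{N}}$ that can be expressed as a finite list of prefix replacements: $f\in V$ if and only if there are finite lists of finite binary words $u_1,\dots,u_m$ and $w_1,\dots,w_m$ such that each infinite binary sequence has exactly one of the $u_i$ as a prefix and exactly one of the $w_i$ as a prefix, and $f(u_i z)=w_i z$ for all $i$ and all $z\in\{0,1\}^{\mathbb{N}}$. A group $G$ embeds into $V$ if there is an injective group homomorphism $G\to V$. The symbol $*$ denotes the free product of groups. *)

(* Defs.v *)
From HB Require Import structures.
From mathcomp Require Import all_boot all_order all_algebra.
From mathcomp Require Import generic_quotient.
From mathcomp Require Import boolp constructive_ereal topology.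
From mathcomp Require Import cantor.

Set Implicit Arguments.
Unset Strict Implicit.
Unset Printing Implicit Defensive.

Local Open Scope quotient_scope.
Local Open Scope group_scope.

(* Maps between groups that preserve products preserve 1 and inverses, so     *)
(* [{multiplicative G -> H}] is the type of group homomorphisms.              *)

Definition isomorphic (G H : groupType) : Prop :=
  exists f : {multiplicative G -> H}, bijective f.

Definition embeds (G H : groupType) : Prop :=
  exists f : {multiplicative G -> H}, injective f.

Section Subgroup.
Variables (G : groupType) (S : groupClosed G).

Record subgroup := Subgroup { subgroup_val : G; subgroupP : subgroup_val \in S }.

HB.instance Definition _ := [isSub for subgroup_val].
HB.instance Definition _ := [Choice of subgroup by <:].

Definition sub_mul (x y : subgroup) := Subgroup (gpredM _ _ (subgroupP x) (subgroupP y)).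
Definition sub_one := Subgroup (@gpred1 G S).
Definition sub_inv (x : subgroup) := Subgroup (gpredVr _ (subgroupP x)).

Fact sub_mulA : associative sub_mul.
Proof. by move=> x y z; apply: val_inj; apply: mulgA. Qed.
Fact sub_mul1 : left_id sub_one sub_mul.
Proof. by move=> x; apply: val_inj; apply: mul1g. Qed.
Fact sub_mulr1 : right_id sub_one sub_mul.
Proof. by move=> x; apply: val_inj; apply: mulg1. Qed.
Fact sub_mulV : left_inverse sub_one sub_inv sub_mul.
Proof. by move=> x; apply: val_inj; apply: mulVg. Qed.
Fact sub_mulrV : right_inverse sub_one sub_inv sub_mul.
Proof. by move=> x; apply: val_inj; apply: mulgV. Qed.

HB.instance Definition _ := isGroup.Build subgroup
  sub_mulA sub_mul1 sub_mulr1 sub_mulV sub_mulrV.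

End Subgroup.

Definition has_subgroup_isomorphic_to (G K : groupType) : Prop :=
  exists S : groupClosed G, isomorphic (subgroup S) K.

Definition finitely_generated (G : groupType) : Prop :=
  exists s : seq G, forall S : groupClosed G,
    {subset s <= S} -> forall x, x \in S.

Section DirectProduct.
Variables (I : finType) (G : I -> groupType).

Definition direct_product : Type := forall i, G i.

HB.instance Definition _ := Choice.on direct_product.

Definition dp_mul (f g : direct_product) : direct_product := fun i => f i * g i.
Definition dp_one : direct_product := fun i => 1.
Definition dp_inv (f : direct_product) : direct_product := fun i => (f i)^-1.

Fact dp_mulA : associative dp_mul.
Proof. by move=> f g h; apply: functional_extensionality_dep => i; apply: mulgA. Qed.
Fact dp_mul1 : left_id dp_one dp_mul.
Proof. by move=> f; apply: functional_extensionality_dep => i; apply: mul1g. Qed.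
Fact dp_mulr1 : right_id dp_one dp_mul.
Proof. by move=> f; apply: functional_extensionality_dep => i; apply: mulg1. Qed.
Fact dp_mulV : left_inverse dp_one dp_inv dp_mul.
Proof. by move=> f; apply: functional_extensionality_dep => i; apply: mulVg. Qed.
Fact dp_mulrV : right_inverse dp_one dp_inv dp_mul.
Proof. by move=> f; apply: functional_extensionality_dep => i; apply: mulgV. Qed.

HB.instance Definition _ := isGroup.Build direct_product
  dp_mulA dp_mul1 dp_mulr1 dp_mulV dp_mulrV.

End DirectProduct.

Section Presentation.

(* The letter (x, true) stands for the generator x, (x, false) for its        *)
(* formal inverse; R l r means that l = r is a defining relation.             *)
Variables (X : choiceType) (R : seq (X * bool) -> seq (X * bool) -> Prop).
Implicit Types u v w l r : seq (X * bool).

Inductive pres_congr : seq (X * bool) -> seq (X * bool) -> Prop :=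
| PresRefl w : pres_congr w w
| PresSym v w : pres_congr v w -> pres_congr w v
| PresTrans u v w : pres_congr u v -> pres_congr v w -> pres_congr u w
| PresCat v v' w w' :
    pres_congr v v' -> pres_congr w w' -> pres_congr (v ++ w) (v' ++ w')
| PresCancel x b : pres_congr [:: (x, b); (x, ~~ b)] [::]
| PresRel l r : R l r -> pres_congr l r.

Definition pres_eqb : rel (seq (X * bool)) := fun v w => `[< pres_congr v w >].

Fact pres_eqb_refl : reflexive pres_eqb.
Proof. by move=> w; apply/asboolP; apply: PresRefl. Qed.
Fact pres_eqb_sym : symmetric pres_eqb.
Proof. by move=> v w; apply/asboolP/asboolP => /PresSym. Qed.
Fact pres_eqb_trans : transitive pres_eqb.
Proof.
by move=> v u w /asboolP uv /asboolP vw; apply/asboolP; apply: PresTrans uv vw.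
Qed.

Canonical pres_equiv :=
  EquivRel pres_eqb pres_eqb_refl pres_eqb_sym pres_eqb_trans.

Definition presented : Type := {eq_quot pres_equiv}.

HB.instance Definition _ := Choice.on presented.
HB.instance Definition _ := Quotient.on presented.

Definition pres_class (w : seq (X * bool)) : presented := \pi_presented w.

Lemma pres_classP v w : pres_class v = pres_class w <-> pres_congr v w.
Proof.
split=> [/eqP|vw]; first by rewrite eqmodE => /asboolP.
by apply/eqP; rewrite eqmodE; apply/asboolP.
Qed.

Definition formal_inv w : seq (X * bool) := rev [seq (a.1, ~~ a.2) | a <- w].

Definition pres_mul (g h : presented) : presented := pres_class (repr g ++ repr h).
Definition pres_one : presented := pres_class [::].
Definition pres_inv (g : presented) : presented := pres_class (formal_inv (repr g)).

Fact pres_class_repr (g : presented) : pres_class (repr g) = g.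
Proof. exact: reprK. Qed.

Fact repr_pres_class w : pres_congr (repr (pres_class w)) w.
Proof. by apply/pres_classP; rewrite pres_class_repr. Qed.

Fact pres_congr_invV w : pres_congr (formal_inv w ++ w) [::].
Proof.
elim: w => [|[x b] w IHw]; first exact: PresRefl.
rewrite /formal_inv /= rev_cons cat_rcons.
apply: PresTrans IHw; apply: PresCat; first exact: PresRefl.
rewrite -[_ :: _ :: w]/([:: (x, ~~ b); (x, b)] ++ w) -[X in pres_congr _ X]cat0s.
apply: PresCat; last exact: PresRefl.
by rewrite -[X in (x, X) :: nil]negbK; apply: PresCancel.
Qed.

Fact formal_invK : involutive formal_inv.
Proof.
move=> w; rewrite /formal_inv map_rev revK -map_comp -[RHS]map_id.
by apply: eq_map => -[x b] /=; rewrite negbK.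
Qed.

Fact pres_mulA : associative pres_mul.
Proof.
move=> f g h; apply/pres_classP.
have L := PresCat (PresRefl (repr f)) (repr_pres_class (repr g ++ repr h)).
have L' := PresCat (repr_pres_class (repr f ++ repr g)) (PresRefl (repr h)).
by apply: PresTrans L _; rewrite catA; apply: PresSym.
Qed.

Fact pres_mul1 : left_id pres_one pres_mul.
Proof.
move=> g; rewrite -[RHS]pres_class_repr; apply/pres_classP.
exact: (PresCat (repr_pres_class [::]) (PresRefl (repr g))).
Qed.

Fact pres_mulr1 : right_id pres_one pres_mul.
Proof.
move=> g; rewrite -[RHS]pres_class_repr; apply/pres_classP.
by rewrite -[X in pres_congr _ X]cats0; apply: PresCat (repr_pres_class [::]); apply: PresRefl.
Qed.

Fact pres_mulV : left_inverse pres_one pres_inv pres_mul.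
Proof.
move=> g; apply/pres_classP; apply: PresTrans (pres_congr_invV (repr g)).
exact: (PresCat (repr_pres_class _) (PresRefl (repr g))).
Qed.

Fact pres_mulrV : right_inverse pres_one pres_inv pres_mul.
Proof.
move=> g; apply/pres_classP.
apply: PresTrans (PresCat (PresRefl (repr g)) (repr_pres_class _)) _.
by rewrite -{1}[repr g]formal_invK; apply: pres_congr_invV.
Qed.

HB.instance Definition _ := isGroup.Build presented
  pres_mulA pres_mul1 pres_mulr1 pres_mulV pres_mulrV.

Lemma pres_class_cat v w : pres_class (v ++ w) = pres_class v * pres_class w.
Proof.
by apply/pres_classP/PresSym; apply: PresCat; apply: repr_pres_class.
Qed.

End Presentation.

Definition free_group (X : choiceType) : groupType :=
  presented (fun _ _ : seq (X * bool) => False).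

Definition is_free (G : groupType) : Prop :=
  exists X : choiceType, isomorphic G (free_group X).

(* G * H is presented by all the elements of G and H as generators, with the  *)
(* multiplication tables of G and H as relations.                             *)
Inductive free_product_rel (G H : groupType) :
    seq ((G + H) * bool) -> seq ((G + H) * bool) -> Prop :=
| FreeProductL (x y : G) :
    free_product_rel [:: (inl x, true); (inl y, true)] [:: (inl (x * y), true)]
| FreeProductR (x y : H) :
    free_product_rel [:: (inr x, true); (inr y, true)] [:: (inr (x * y), true)].

Definition free_product (G H : groupType) : groupType :=
  presented (@free_product_rel G H).

Definition groupZ : groupType := Algebra.to_multiplicative int.

Record sgraph := SGraph {
  vertex :> finType;
  edge : rel vertex;
  edge_sym : symmetric edge;
  edge_irrefl : irreflexive edge
}.

Inductive graph_group_rel (Gamma : sgraph) :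
    seq (Gamma * bool) -> seq (Gamma * bool) -> Prop :=
| GraphGroupComm (u v : Gamma) : edge u v ->
    graph_group_rel [:: (u, true); (v, true)] [:: (v, true); (u, true)].

Definition graph_group (Gamma : sgraph) : groupType :=
  presented (@graph_group_rel Gamma).

Section CommutingPartitions.
Variable Gamma : sgraph.
Implicit Types u v : Gamma.

Definition walk (n : nat) u v : bool :=
  [exists p : n.-tuple Gamma, path (@edge Gamma) u p && (last u p == v)].

Definition distance u v : \bar int :=
  match pselect (exists n, walk n u v) with
  | left uv => (Posz (ex_minn uv))%:E
  | right _ => +oo
  end%E.

(* For a one-vertex graph the maximum is over the empty set and is 0.         *)
Definition eccentricity v : \bar int :=
  \big[maxe/0%E]_(u : Gamma | u != v) distance v u.

Definition commuting_partition (n : nat) (P : 'I_n.+1 -> {set Gamma}) : Prop :=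
  [/\ [/\ \bigcup_i P i = [set: Gamma],
          forall i j, i != j -> [disjoint P i & P j] &
          forall i, i != ord0 -> P i != set0],
      P ord0 = [set v | eccentricity v == 1%E],
      forall k u v, k != ord0 -> u \in P k -> v \in P k -> ~~ edge u v &
      forall i j u v, i != j -> u \in P i -> v \in P j -> edge u v].

Definition GP : Prop :=
  exists (n : nat) (P : 'I_n.+1 -> {set Gamma}), commuting_partition P.

End CommutingPartitions.

Section ThompsonV.
Local Open Scope nat_scope.
Implicit Types (u w s : seq bool) (z : cantor_space).
Implicit Types f g : cantor_space -> cantor_space.

Definition is_prefix u z : bool := u == mkseq z (size u).

Definition prepend u z : cantor_space := fun n => nth (z (n - size u)) u n.

Definition homeomorphism f : Prop :=
  exists g, [/\ cancel f g, cancel g f, continuous f & continuous g].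

Definition complete_prefix_code (us : seq (seq bool)) : Prop :=
  forall z, count (is_prefix^~ z) us = 1.

(* The entries of t are the pairs (u_i, w_i).                                 *)
Definition prefix_replacement f : Prop :=
  exists t : seq (seq bool * seq bool),
    [/\ complete_prefix_code (unzip1 t), complete_prefix_code (unzip2 t) &
        forall u w, (u, w) \in t -> forall z, f (prepend u z) = prepend w z].

Definition thompson_V : Type :=
  {f : cantor_space -> cantor_space |
    `[< homeomorphism f /\ prefix_replacement f >]}.

HB.instance Definition _ := Choice.on thompson_V.

Fact is_prefixP u z : reflect (exists z', z = prepend u z') (is_prefix u z).
Proof.
apply: (iffP eqP) => [uz|[z' ->]].
  exists (fun n => z (size u + n)); apply: functional_extensionality_dep => n.
  rewrite /prepend; have [nu|un] := ltnP n (size u).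
    by rewrite -(nth_mkseq (z (size u + (n - size u))) z nu) -uz.
  by rewrite nth_default // subnKC.
apply: (@eq_from_nth _ false); first by rewrite size_mkseq.
by move=> i iu; rewrite nth_mkseq // /prepend (set_nth_default false).
Qed.

Fact prependA u w z : prepend (u ++ w) z = prepend u (prepend w z).
Proof.
apply: functional_extensionality_dep => n; rewrite /prepend nth_cat size_cat.
case: ltnP => [nu|un]; first exact: set_nth_default.
by rewrite [RHS]nth_default // subnDA.
Qed.

Fact prepend_inj u : injective (prepend u).
Proof.
move=> z z' zz'; apply: functional_extensionality_dep => n.
have := congr1 (fun y : cantor_space => y (size u + n)) zz'.
by rewrite /prepend !nth_default ?leq_addr // addKn.
Qed.

Fact is_prefix_cat u w z : is_prefix (u ++ w) (prepend u z) = is_prefix w z.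
Proof.
apply/is_prefixP/is_prefixP => -[z' ].
  by rewrite prependA => /prepend_inj ->; exists z'.
by move=> ->; exists z'; rewrite prependA.
Qed.

Fact is_prefix_catW u w z : is_prefix (u ++ w) z -> is_prefix u z.
Proof.
by case/is_prefixP => z' ->; apply/is_prefixP; rewrite prependA; eexists.
Qed.

Fact prefix_replacement_of_domain f g t : cancel f g -> cancel g f ->
  complete_prefix_code (unzip1 t) ->
  (forall u w, (u, w) \in t -> forall z, f (prepend u z) = prepend w z) ->
  prefix_replacement f.
Proof.
move=> fK gK tP ft; exists t; split=> // z.
rewrite -(tP (g z)) /unzip1 /unzip2 !count_map; apply: eq_in_count => -[u w] uwt.
apply/is_prefixP/is_prefixP => /= -[z' zE]; exists z'.
  by rewrite zE -(ft u w) // fK.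
by rewrite -(ft u w) // -zE gK.
Qed.

Fact in_V_id : homeomorphism id /\ prefix_replacement id.
Proof.
split; first by exists id; split=> // z; apply: cvg_id.
exists [:: ([::], [::])]; split=> // u w.
by rewrite inE => /eqP[-> ->].
Qed.

Fact in_V_comp f g : homeomorphism f /\ prefix_replacement f ->
  homeomorphism g /\ prefix_replacement g ->
  homeomorphism (g \o f) /\ prefix_replacement (g \o f).
Proof.
move=> [[f' [fK f'K cf cf']] [t [tP _ ft]]] [[g' [gK g'K cg cg']] [s [sP _ gs]]].
split.
  exists (f' \o g'); split; [exact: can_comp| exact: can_comp| |].
    by move=> z; apply: continuous_comp; [exact: cf| exact: cg].
  by move=> z; apply: continuous_comp; [exact: cg'| exact: cf'].
pose N := \max_(p <- s) size p.1.
have sN u w : (u, w) \in s -> size u <= N.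
  by move=> uws; rewrite /N (big_rem _ uws) /= leq_maxl.
pose S := [seq tval x | x <- enum {: N.-tuple bool}].
have SP z : count (is_prefix^~ z) S = 1.
  pose m := [tuple of mkseq z N].
  rewrite /S count_map (@eq_count _ _ (pred1 m)) => [|x /=].
    by rewrite count_uniq_mem ?enum_uniq ?mem_enum.
  by rewrite /is_prefix size_tuple.
pose h (x : seq bool) :=
  if [seq p <- s | p.1 == take (size p.1) x] is p :: _
  then p.2 ++ drop (size p.1) x else x.
have hP x z : size x >= N -> g (prepend x z) = prepend (h x) z.
  move=> xN; rewrite /h.
  case E: [seq p <- s | _] => [|p r].
    have := sP (prepend x z); rewrite /unzip1 count_map -size_filter.
    rewrite (@eq_in_filter _ _ (fun p => p.1 == take (size p.1) x)) ?E //.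
    move=> [u w] /sN ux /=.
    have ux' : size (take (size u) x) = size u.
      by rewrite size_takel // (leq_trans ux).
    apply/is_prefixP/eqP => [[z' xz]|uE].
      apply: (@eq_from_nth _ false) => // i iu.
      have := congr1 (fun y : cantor_space => y i) xz.
      rewrite /prepend (set_nth_default false) ?(leq_trans iu) ?(leq_trans ux) //.
      by rewrite nth_take // => ->; apply: set_nth_default.
    exists (prepend (drop (size u) x) z).
    by rewrite -prependA {1}uE cat_take_drop.
  have: p \in [seq p <- s | p.1 == take (size p.1) x] by rewrite E mem_head.
  rewrite mem_filter => /andP[/eqP pE ps].
  rewrite -{1}[x](cat_take_drop (size p.1)) -pE !prependA.
  by apply: gs; rewrite -surjective_pairing.
pose t' := [seq (p.1 ++ x, h (p.2 ++ x)) | p <- t, x <- S].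
apply: (@prefix_replacement_of_domain _ (f' \o g') t').
- exact: can_comp.
- exact: can_comp.
- move=> z; rewrite -(tP z) /unzip1 !count_map /t' count_flatten -map_comp.
  rewrite -[RHS]sumn_count; congr sumn; apply: eq_map => p /=.
  rewrite count_map; case: (boolP (is_prefix p.1 z)) => [/is_prefixP[z' ->]|pz].
    rewrite -[RHS](SP z'); apply: eq_count => x /=.
    exact: is_prefix_cat.
  apply/eqP; rewrite -leqn0 leqNgt -has_count; apply/hasPn => x _ /=.
  by apply: contra pz; apply: is_prefix_catW.
- move=> u w /allpairsP[] [p x] /= [pt xS] [-> ->] z.
  rewrite prependA (ft p.1 p.2) -?surjective_pairing // -prependA hP //.
  case/mapP: xS => y _ ->.
  by rewrite size_cat size_tuple leq_addl.
Qed.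

Fact in_V_inv f g : cancel f g -> cancel g f ->
  homeomorphism f /\ prefix_replacement f ->
  homeomorphism g /\ prefix_replacement g.
Proof.
move=> fK gK [[g' [fK' gK' cf cg]] [t [tP t'P ft]]].
have gg' : g' = g.
  by apply: functional_extensionality_dep => z; rewrite -{1}[z]gK fK'.
rewrite gg' in cg; split; first by exists f.
exists [seq (p.2, p.1) | p <- t]; split.
- by rewrite /unzip1 -map_comp.
- by rewrite /unzip2 -map_comp.
- by move=> u w /mapP[[u' w'] uwt [-> ->]] z /=; rewrite -(ft u' w') // fK.
Qed.

Definition V_mul (f g : thompson_V) : thompson_V :=
  exist _ (val f \o val g)
    (asboolT (in_V_comp (asboolW (valP g)) (asboolW (valP f)))).

Definition V_one : thompson_V := exist _ id (asboolT in_V_id).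

Fact V_inv_exists (f : thompson_V) :
  exists g : thompson_V, cancel (val f) (val g) /\ cancel (val g) (val f).
Proof.
have fV := asboolW (valP f); have [[g [fK gK _ _]] _] := fV.
by exists (exist _ g (asboolT (in_V_inv fK gK fV))).
Qed.

Definition V_inv (f : thompson_V) : thompson_V := projT1 (cid (V_inv_exists f)).

Fact V_mulA : associative V_mul.
Proof. by move=> f g h; apply: val_inj. Qed.
Fact V_mul1 : left_id V_one V_mul.
Proof. by move=> f; apply: val_inj. Qed.
Fact V_mulr1 : right_id V_one V_mul.
Proof. by move=> f; apply: val_inj. Qed.
Fact V_mulV : left_inverse V_one V_inv V_mul.
Proof.
move=> f; apply: val_inj; apply: functional_extensionality_dep => z /=.
by rewrite /V_inv; case: cid => g [fK gK] /=; rewrite fK.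
Qed.
Fact V_mulrV : right_inverse V_one V_inv V_mul.
Proof.
move=> f; apply: val_inj; apply: functional_extensionality_dep => z /=.
by rewrite /V_inv; case: cid => g [fK gK] /=; rewrite gK.
Qed.

HB.instance Definition _ := isGroup.Build thompson_V
  V_mulA V_mul1 V_mulr1 V_mulV V_mulrV.

End ThompsonV.

(* Main.v *)
(* A graph lies in the class GP exactly when non-adjacency is transitive. Its graph group is
   then the direct product of the free groups on the non-adjacency classes, and V contains
   such products: free groups by ping-pong, products by acting on disjoint cones. Otherwise
   an edge {u, v} and a vertex w adjacent to neither of its ends span a retract Z^2 * Z of
   the graph group. So everything rests on Z^2 * Z not embedding into V.

   Suppose that it does. Call a point important for f in V if it is periodic with
   nontrivial germs; there are finitely many, and orbits of f that are not periodic
   accumulate only there. After passing to powers, A = Z^2 fixes pointwise the finite set P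
   of its important points, and the points moved by A outside a neighbourhood of P can be
   pushed by a single element of A into that neighbourhood. Germs at a fixed point form a
   cyclic group, so at each p in P some nontrivial element of A is trivial near p. As A is
   malnormal in Z^2 * Z, a descent over P produces an element outside A which is trivial
   near P, and conjugation arguments give u <> 1 which is moreover trivial at all fixed
   points of A. Some g <> 1 in A moves the support of u off itself, so u commutes with
   g u g^-1; in Z^2 * Z this forces u in A, and then u = 1. *)

From HB Require Import structures.
Require Import Defs.
From mathcomp Require Import all_boot all_order all_algebra.
From mathcomp Require Import boolp classical_sets functions filter topology cantor constructive_ereal.
From mathcomp Require Import zify ring.

Set Implicit Arguments.
Unset Strict Implicit.
Unset Printing Implicit Defensive.

Import Order.TTheory GRing.Theory Num.Theory.

(** * Words and cones in the Cantor space *)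

Section Words.
Implicit Types (x y z p q : cantor_space) (u v w s : seq bool) (f g : cantor_space -> cantor_space).

(** Triviality near P alone does not confine the support of u: A may also fix points outside P, near
    which all of A acts trivially and cannot push anything. This is why u has to be made trivial at
    all fixed points of A before an element of A can displace its support.

    The descent is an order argument. Suppose that elements trivial near Q exist outside A, but none
    of them is also trivial near p. Malnormality then forces the images of p under elements trivial
    near Q to come arbitrarily close to another point of P with the same defect, and this relation
    is a strict order without maximal elements on a finite set.

    The facts on Z^2 * Z come from matrices rather than from word combinatorics. Unitriangular
    matrices over Z[X][Y] represent the group so that A consists of the elements with lower left
    entry c = 0. Malnormality and the statement on commuting conjugates become equations c t c' = 0
    and 2 t c^2 = 0 in a domain.

    Powers are taken by composing the embedding with an endomorphism [kappa] that multiplies Z^2 by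
    a common period and fixes Z, so the acting group remains Z^2 * Z. *)

Lemma cantor_eqP x y : x =1 y -> x = y.
Proof. exact: functional_extensionality_dep. Qed.

Definition agree n x y := forall i, i < n -> x i = y i.

Definition shift n x : cantor_space := fun i => x (n + i).

Definition cone_map f u w := forall z, f (prepend u z) = prepend w z.

Definition locally_trivial f p := exists n, forall y, agree n p y -> f y = y.

Lemma agree_sym n x y : agree n x y -> agree n y x.
Proof. by move=> h i /h. Qed.

Lemma agree_trans n x y z : agree n x y -> agree n y z -> agree n x z.
Proof. by move=> h k i lt_in; rewrite h // k. Qed.

Lemma agree_le m n x y : m <= n -> agree n x y -> agree m x y.
Proof. by move=> le_mn h i lt_im; apply: h; apply: leq_trans le_mn. Qed.

Lemma agree_eq x y : (forall n, agree n x y) -> x = y.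
Proof. by move=> h; apply: cantor_eqP => i; apply: (h i.+1). Qed.

Lemma disagree x y : x <> y -> exists n, ~ agree n x y.
Proof. by move=> xy; apply: contrapT => /forallNP h; apply/xy/agree_eq => n; apply: contrapT. Qed.

Lemma mkseq_shift n x : prepend (mkseq x n) (shift n x) = x.
Proof.
apply: cantor_eqP => i; rewrite /prepend size_mkseq /shift.
case: (ltnP i n) => [lt_in|le_ni]; first by rewrite nth_mkseq.
by rewrite nth_default ?size_mkseq // subnKC.
Qed.

Lemma prepend_nth u z i : i < size u -> prepend u z i = nth false u i.
Proof. by move=> iu; apply: set_nth_default. Qed.

Lemma prepend_shift u z i : prepend u z (size u + i) = z i.
Proof. by rewrite /prepend nth_default ?leq_addr // addKn. Qed.

Lemma agree_prepend u n z y : agree n z y -> agree (size u + n) (prepend u z) (prepend u y).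
Proof.
move=> h i lt_i; rewrite /prepend.
case: (ltnP i (size u)) => iu; first exact: set_nth_default.
by rewrite !nth_default // h // ltn_subLR.
Qed.

Lemma agree_prepend0 u z y : agree (size u) (prepend u z) (prepend u y).
Proof. by have := @agree_prepend u 0 z y; rewrite addn0; apply. Qed.

Lemma agree_mkseq n x y : agree n x y <-> mkseq x n = mkseq y n.
Proof.
split=> [h|e i lt_in].
  by apply/eq_in_map => i; rewrite mem_iota => /h.
by rewrite -(nth_mkseq false x lt_in) e nth_mkseq.
Qed.

Lemma agreeP n x y : agree n x y -> y = prepend (mkseq x n) (shift n y).
Proof. by move/agree_mkseq ->; rewrite mkseq_shift. Qed.

Lemma mkseq_prepend u z : mkseq (prepend u z) (size u) = u.
Proof.
apply: (@eq_from_nth _ false); rewrite size_mkseq // => i iu.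
by rewrite nth_mkseq // prepend_nth.
Qed.

Lemma shift_prepend u z : shift (size u) (prepend u z) = z.
Proof. by apply: cantor_eqP => i; rewrite /shift prepend_shift. Qed.

Lemma mkseq_prepend_size u z n : size u = n -> mkseq (prepend u z) n = u.
Proof. by move <-; apply: mkseq_prepend. Qed.

Lemma shift_prepend_size u z n : size u = n -> shift n (prepend u z) = z.
Proof. by move <-; apply: shift_prepend. Qed.

Lemma mkseqD x m n : mkseq x (m + n) = mkseq x m ++ mkseq (shift m x) n.
Proof. by rewrite /mkseq iotaD map_cat add0n -[in iota m n](addn0 m) iotaDl -map_comp. Qed.

Lemma mkseq_le x m n : m <= n -> mkseq x n = mkseq x m ++ mkseq (shift m x) (n - m).
Proof. by move=> le_mn; rewrite -mkseqD subnKC. Qed.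

Lemma prepend_cat_take u n z : n <= size u -> prepend u z = prepend (take n u) (prepend (drop n u) z).
Proof. by rewrite -prependA cat_take_drop. Qed.

Lemma prepend_eq_prefix u w z z' : size u <= size w -> prepend u z = prepend w z' ->
  exists v, w = u ++ v.
Proof.
move=> le_uw e; exists (drop (size u) w).
rewrite -{1}(cat_take_drop (size u) w); congr cat.
rewrite -[RHS](mkseq_prepend u z) e (prepend_cat_take z' le_uw).
by have := mkseq_prepend (take (size u) w) (prepend (drop (size u) w) z'); rewrite size_takel.
Qed.

Lemma prepend_fix_nil v : (forall z, prepend v z = z) -> v = [::].
Proof.
case: v => // b v /(_ (fun=> ~~ b)) /(congr1 (fun y : cantor_space => y 0)).
by rewrite /prepend /=; case: b.
Qed.

(** For nonempty [v] this is the only fixed point of [prepend v]. For empty [v] it is constantly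
    [false], a mere dummy value. *)
Definition omega v : cantor_space := fun i => nth false v (i %% size v).

Lemma omegaE v : v <> [::] -> prepend v (omega v) = omega v.
Proof.
move=> vN0; apply: cantor_eqP => i; rewrite /omega.
have v0 : 0 < size v by case: (v) vN0.
case: (ltnP i (size v)) => iv; first by rewrite prepend_nth // modn_small.
by rewrite -{1}(subnKC iv) prepend_shift -{2}(subnKC iv) modnDl.
Qed.

Lemma prepend_fix_unique v z z' : v <> [::] ->
  prepend v z = z -> prepend v z' = z' -> z = z'.
Proof.
move=> vN0 zE z'E; apply: cantor_eqP => i.
have v0 : 0 < size v by case: (v) vN0.
elim: i {-2}i (leqnn i) => [|n IHn] i le_in.
  by rewrite -zE -z'E !prepend_nth ?(leq_ltn_trans le_in).
case: (ltnP i (size v)) => iv; first by rewrite -zE -z'E !prepend_nth.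
rewrite -zE -z'E -(subnKC iv) !prepend_shift; apply: IHn.
by rewrite leq_subLR (leq_trans le_in) // -add1n leq_add2r.
Qed.

Fixpoint wpow v n : seq bool := if n is m.+1 then v ++ wpow v m else [::].

Lemma size_wpow v n : size (wpow v n) = n * size v.
Proof. by elim: n => //= n IHn; rewrite size_cat IHn mulSn. Qed.

Lemma wpowD v m n : wpow v (m + n) = wpow v m ++ wpow v n.
Proof. by elim: m => //= m IHm; rewrite IHm catA. Qed.

Lemma wpow_nil v n : v <> [::] -> 0 < n -> wpow v n <> [::].
Proof. by case: v n => // b v [|n]. Qed.

Lemma omega_wpow v n : v <> [::] -> prepend (wpow v n) (omega v) = omega v.
Proof.
move=> vN0; elim: n => [|n IHn] /=; last by rewrite prependA IHn omegaE.
by apply: cantor_eqP => i; rewrite /prepend nth_nil subn0.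
Qed.

Lemma omega_wpow_unique v n z : v <> [::] -> 0 < n -> prepend (wpow v n) z = z -> z = omega v.
Proof.
by move=> vN0 n0 h; apply: prepend_fix_unique h (omega_wpow n vN0); apply: wpow_nil.
Qed.

Lemma prepend0 z : prepend [::] z = z.
Proof. by apply: cantor_eqP => i; rewrite /prepend nth_nil subn0. Qed.

(** Compactness by König's argument: a word is good if finitely many cones from [Q] cover its cone.
    A bad word has a bad one-letter extension, so a bad empty word would start an infinite branch of
    bad words, although some prefix of that branch satisfies [Q]. *)
Lemma cantor_cover (Q : seq bool -> Prop) : (forall x, exists n, Q (mkseq x n)) ->
  exists E : seq (seq bool), (forall u, u \in E -> Q u) /\
    forall x, exists2 u, u \in E & exists z, x = prepend u z.
Proof.
move=> Qx.
pose good u := exists E : seq (seq bool), (forall v, v \in E -> Q v) /\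
    forall z, exists2 v, v \in E & exists z', prepend u z = prepend v z'.
suff [E [EQ EP]] : good [::].
  by exists E; split=> // x; have [v vE [z e]] := EP x; exists v; [|exists z; rewrite -e prepend0].
apply: contrapT => bad0.
have step u : exists b, ~ good u -> ~ good (rcons u b).
  apply: contrapT => /forallNP h.
  have [/not_implyP[bu /contrapT [E1 [Q1 P1]]] /not_implyP[_ /contrapT [E2 [Q2 P2]]]] :=
    (h true, h false).
  apply: bu; exists (E1 ++ E2); split=> [v|z].
    by rewrite mem_cat => /orP[/Q1|/Q2].
  rewrite -(mkseq_shift 1 z) -prependA /mkseq /= cats1.
  case: (z 0); [have [v vE e] := P1 (shift 1 z)|have [v vE e] := P2 (shift 1 z)];
    by exists v => //; rewrite mem_cat vE ?orbT.
pose next u := projT1 (cid (step u)).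
pose br := fix br n := if n is m.+1 then rcons (br m) (next (br m)) else [::].
have szbr n : size (br n) = n by elim: n => //= n IHn; rewrite size_rcons IHn.
have badbr n : ~ good (br n).
  by elim: n => //= n IHn; rewrite /next; case: cid => b /= ; apply.
pose x : cantor_space := fun n => next (br n).
have brE n : mkseq x n = br n.
  by elim: n => // n IHn; rewrite mkseqS IHn.
have [n Qn] := Qx x; apply: (badbr n); rewrite -brE; exists [:: mkseq x n]; split.
  by move=> v; rewrite inE => /eqP ->.
by move=> z; exists (mkseq x n); [rewrite inE|exists z].
Qed.

Lemma pigeonhole (T : eqType) (E : seq T) (Q : nat -> T -> Prop) :
  (forall J, exists j t, [/\ J <= j, t \in E & Q j t]) ->
  exists2 t, t \in E & forall J, exists2 j, J <= j & Q j t.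
Proof.
elim: E => [|t E IHE] h; first by have [j [t []]] := h 0.
have [tQ|/existsNP[J0 tQ]] := pselect (forall J, exists2 j, J <= j & Q j t).
  by exists t; rewrite ?mem_head.
have [J|s sE sQ] := IHE; last by exists s; rewrite // inE sE orbT.
have [j [s [le_j]]] := h (maxn J J0).
move: le_j; rewrite geq_max inE => /andP[le_j le_j0] /orP[/eqP ->|sE] Qjs.
  by case: tQ; exists j.
by exists j, s.
Qed.

Definition words n : seq (seq bool) := [seq tval t | t : n.-tuple bool].

Lemma mem_words n u : (u \in words n) = (size u == n).
Proof.
apply/mapP/eqP => [[t _ ->]|un]; first by rewrite size_tuple.
by exists (tcast un (in_tuple u)); rewrite ?mem_enum // val_tcast.
Qed.

Definition words_le n : seq (seq bool) := flatten [seq words i | i <- iota 0 n.+1].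

Lemma mem_words_le n u : (u \in words_le n) = (size u <= n).
Proof.
apply/flatten_mapP/idP => [[i]|un].
  by rewrite mem_iota mem_words => /andP[_ le_in] /eqP ->.
by exists (size u); rewrite ?mem_iota ?mem_words.
Qed.

End Words.

(** * Local dynamics of a prefix replacement *)

Section Dynamics.
Variables (f : cantor_space -> cantor_space) (L : nat).
Hypothesis f_inj : injective f.
Hypothesis fL : forall u, size u = L -> exists w, cone_map f u w.
Implicit Types (x y z p q : cantor_space) (u v w s tau rho : seq bool).

Lemma cone_map_long u : L <= size u -> exists w, cone_map f u w.
Proof.
move=> Lu; have [w fw] := fL (size_takel Lu).
by exists (w ++ drop L u) => z; rewrite (prepend_cat_take _ Lu) fw prependA.
Qed.

Lemma agree_f n x y : agree (L + n) x y -> agree n (f x) (f y).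
Proof.
move=> h; have [w fw] := fL (size_mkseq x L).
rewrite (agreeP (agree_le (leq_addr n L) h)) -{1}(mkseq_shift L x) !fw.
apply: (@agree_le _ (size w + n)); first exact: leq_addl.
by apply: agree_prepend => i lt_in; apply: h; rewrite ltn_add2l.
Qed.

Lemma agree_iter j n : exists m, forall x y, agree m x y -> agree n (iter j f x) (iter j f y).
Proof.
elim: j n => [|j IHj] n; first by exists n.
by have [m mP] := IHj (L + n); exists m => x y /mP /agree_f.
Qed.

Lemma iter_inj j : injective (iter j f).
Proof. by elim: j => // j IHj x y /= /f_inj /IHj. Qed.

Lemma iterC a b x : iter a f (iter b f x) = iter b f (iter a f x).
Proof. by rewrite -!iterD addnC. Qed.

Lemma iter_mul_fix l M x : iter l f x = x -> iter (l * M) f x = x.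
Proof. by move=> h; elim: M => [|M IHM]; rewrite ?muln0 // mulnS iterD IHM. Qed.

Lemma iter_sub a b x : a <= b -> iter a f x = iter b f x -> iter (b - a) f x = x.
Proof. by move=> ab; rewrite -{1}(subnKC ab) iterD => /iter_inj /esym. Qed.

(* With [(a, b) = (r, 0)] the point [tau rho rho ...] is an attracting fixed point of
   [iter r f], with [(a, b) = (0, r)] a repelling one. *)
Section Hyperbolic.
Variables (a b : nat) (tau rho : seq bool).
Hypothesis rhoN0 : rho <> [::].
Hypothesis hyp : forall z, iter a f (prepend tau z) = iter b f (prepend tau (prepend rho z)).

Lemma hyperbolic_iter M z :
  iter (a * M) f (prepend tau z) = iter (b * M) f (prepend tau (prepend (wpow rho M) z)).
Proof.
elim: M => [|M IHM] in z *; first by rewrite !muln0 /= prepend0.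
by rewrite !mulnS !iterD IHM iterC hyp -!prependA /= -catA iterC.
Qed.

(** With [M = l] both sides of [hyperbolic_iter] iterate a multiple of the period, so injectivity
    leaves [z] fixed by [prepend (wpow rho l)]. *)
Lemma hyperbolic_periodic l z : 0 < l -> iter l f (prepend tau z) = prepend tau z -> z = omega rho.
Proof.
move=> l0 h; have := hyperbolic_iter l z.
rewrite !(mulnC _ l) (iter_mul_fix a h) -{1}(iter_mul_fix b h) => /iter_inj /prepend_inj /esym.
exact: omega_wpow_unique.
Qed.

Lemma hyperbolic_not_trivial l : 0 < l -> ~ locally_trivial (iter l f) (prepend tau (omega rho)).
Proof.
(* Any power of [rho] of length at least [n] keeps the point in the trivial neighbourhood; being a
   power of [rho], it can be exchanged with [wpow rho l] in the final comparison. *)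
move=> l0 [n triv]; pose w := wpow rho n.
have nw : n <= size (tau ++ w).
  rewrite size_cat size_wpow; apply: leq_trans (leq_addl _ _).
  by rewrite leq_pmulr //; case: (rho) rhoN0.
have near z : agree n (prepend tau (omega rho)) (prepend tau (prepend w z)).
  rewrite -(omega_wpow n rhoN0) -!prependA.
  exact: agree_le nw (@agree_prepend0 _ _ _).
have fixM M z : iter (M * l) f (prepend tau (prepend w z)) = prepend tau (prepend w z).
  by rewrite mulnC; apply/iter_mul_fix/triv.
suff /prepend_fix_nil : forall z, prepend (wpow rho l) z = z by apply: wpow_nil.
move=> z; have := hyperbolic_iter l (prepend w z).
rewrite -[prepend (wpow rho l) _]prependA -wpowD addnC wpowD prependA !fixM.
by move=> /prepend_inj /prepend_inj.
Qed.

End Hyperbolic.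

(** In the attracting case all neighbours of [x] are drawn to a periodic orbit. In the repelling
    case they are not, and the extra clause says that [x] itself runs into the repelling point; this
    will make [x] important. *)
Definition local_dynamics x :=
  (exists c r, 0 < r /\ forall y, agree c x y -> iter r f y = y) \/
  (exists c n r tau rho, [/\ 0 < r, rho <> [::],
     forall y, agree c x y -> exists z, iter n f y = prepend tau z &
     cone_map (iter r f) tau (tau ++ rho) \/
     cone_map (iter r f) (tau ++ rho) tau /\ iter n f x = prepend tau (omega rho)]).

Lemma iter_cone_nbhd j x s z : iter j f x = prepend s z ->
  exists c, forall y, agree c x y -> exists z', iter j f y = prepend s z'.
Proof.
move=> e; have [m mP] := agree_iter j (size s).
exists m => y /mP; rewrite e => /agreeP; rewrite mkseq_prepend => ->.
by eexists.
Qed.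

Lemma contracting_cone x n r s rho z : 0 < r -> iter n f x = prepend s z ->
  cone_map (iter r f) s (s ++ rho) -> local_dynamics x.
Proof.
move=> r0 e h; have [c cP] := iter_cone_nbhd e.
case: (eqVneq rho [::]) => [rho0|/eqP rhoN0]; last first.
  by right; exists c, n, r, s, rho; split=> //; left.
left; exists c, r; split=> // y /cP [z' e'].
by apply: (@iter_inj n); rewrite iterC e' h rho0 cats0.
Qed.

(** The depth [c] is the same for all iterates: the orbit of this cone never has to be split. *)
Definition regular y c := forall i, exists w, cone_map (iter i f) (mkseq y c) w.

Lemma regular_le y c c' : c <= c' -> regular y c -> regular y c'.
Proof.
move=> le_cc h i; have [w wP] := h i.
exists (w ++ mkseq (shift c y) (c' - c)) => z.
by rewrite (mkseq_le y le_cc) !prependA wP.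
Qed.

Lemma cone_image g y c w : cone_map g (mkseq y c) w -> g y = prepend w (shift c y).
Proof. by move=> h; rewrite -{1}(mkseq_shift c y) h. Qed.

Lemma regular_iter y c j : regular y c -> exists c', regular (iter j f y) c'.
Proof.
move=> h; have [w wP] := h j; exists (size w) => i; rewrite (cone_image wP) mkseq_prepend.
by have [w' w'P] := h (i + j); exists w' => z; rewrite -wP -iterD.
Qed.

Lemma regular_break y c : ~ regular y c -> exists i s,
  [/\ cone_map (iter i f) (mkseq y c) s, size s < L &
      forall w, ~ cone_map (iter i.+1 f) (mkseq y c) w].
Proof.
move=> nreg.
have [i [[s sP] ni]] : exists i, (exists w, cone_map (iter i f) (mkseq y c) w) /\
    ~ (exists w, cone_map (iter i.+1 f) (mkseq y c) w).
  apply: contrapT => /forallNP h; apply: nreg; elim=> [|i IHi]; first by exists (mkseq y c).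
  by apply: contrapT => ni; apply: (h i).
exists i, s; split=> // [|w wP]; last by apply: ni; exists w.
rewrite ltnNge; apply/negP => /cone_map_long [w wP].
by apply: ni; exists w => z; rewrite iterS sP wP.
Qed.

(* At the last break, the next letter completes a word of length at most [L]. *)
Lemma regular_short y c : regular y c -> exists i, regular (iter i f y) L.
Proof.
elim: c y => [|c IHc] y reg; first by exists 0; apply: regular_le reg.
have [/IHc //|/regular_break [i [s [sP sL _]]]] := pselect (regular y c).
exists i; apply: regular_le sL _ => j.
have -> : mkseq (iter i f y) (size s).+1 = s ++ [:: y c].
  rewrite (cone_image sP) -addn1 mkseqD mkseq_prepend shift_prepend.
  by rewrite /shift /mkseq /= addn0.
have [w wP] := reg (j + i); exists w => z; rewrite -wP iterD mkseqS -cats1 !prependA.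
by rewrite sP.
Qed.

(** Infinitely many iterates of [x] are regular at depth [L] and start with the same word [s]. If
    the cone [s] is at some return mapped to a word of length at least [L], that word extends [s]
    and an iterate contracts the cone. Otherwise the image words are bounded, two of them coincide,
    and an iterate is trivial on the cone. *)
Lemma regular_dynamics x c : regular x c -> local_dynamics x.
Proof.
move=> reg.
have [s sE sP] : exists2 s, s \in words L & forall J, exists2 j, J <= j &
    regular (iter j f x) L /\ mkseq (iter j f x) L = s.
  apply: pigeonhole => J.
  have [c' /regular_short [i regi]] := regular_iter J reg.
  exists (i + J), (mkseq (iter (i + J) f x) L).
  by rewrite leq_addl mem_words size_mkseq iterD.
have sL : size s = L by apply/eqP; rewrite -mem_words.
have [j0 _ [reg0 s0]] := sP 0.
have x0 : iter j0 f x = prepend s (shift L (iter j0 f x)) by rewrite -s0 mkseq_shift.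
have [[j [w [jj0 wP wL [e]]]]|nlong] := pselect (exists j w, [/\ j0 < j,
    cone_map (iter (j - j0) f) s w, L <= size w & mkseq (iter j f x) L = s]).
  have fx : iter j f x = prepend w (shift L (iter j0 f x)).
    by rewrite -wP -x0 -iterD subnK // ltnW.
  have [rho wE] : exists rho, w = s ++ rho.
    rewrite -e; apply: (@prepend_eq_prefix _ _ (shift L (iter j f x))); first by rewrite size_mkseq.
    by rewrite mkseq_shift; exact: fx.
  apply: (@contracting_cone x j0 (j - j0) s rho _ _ x0); first by rewrite subn_gt0.
  by rewrite -wE.
have [w wE wP] : exists2 w, w \in words_le L & forall J, exists2 j, J <= j &
    j0 < j /\ cone_map (iter (j - j0) f) s w.
  apply: pigeonhole => J; have [j jJ [regj sj]] := sP (maxn J j0.+1).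
  move: jJ; rewrite geq_max => /andP[jJ jj0].
  have [w wP] := reg0 (j - j0); rewrite s0 in wP.
  exists j, w; split=> //; rewrite mem_words_le leqNgt; apply/negP => wL.
  by apply: nlong; exists j, w; split=> //; apply: ltnW.
have [j1 _ [j01 c1]] := wP 0; have [j2 j12 [j02 c2]] := wP j1.+1.
apply: (@contracting_cone x j0 (j2 - j1) s [::] _ _ x0); first by rewrite subn_gt0.
move=> z; rewrite cats0.
have <- : (j2 - j0) - (j1 - j0) = j2 - j1 by rewrite subnBA ?subnK // ltnW.
by apply: iter_sub; [rewrite leq_sub2r // ltnW|rewrite c1 c2].
Qed.

(* Infinitely often an iterate maps a shrinking cone around [x] exactly onto one and the
   same cone [s]; comparing two such times gives an expansion of [s], and comparing with
   all of them shows that the orbit of [x] hits its fixed point. *)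
Lemma irregular_dynamics x : (forall c, ~ regular x c) -> local_dynamics x.
Proof.
move=> irr.
have [s sE sP] : exists2 s, s \in words L & forall c, exists2 c', c <= c' &
    exists j, cone_map (iter j f) (mkseq x c') s.
  apply: pigeonhole => c; have [i [s [sP sL _]]] := regular_break (irr c).
  exists (c + (L - size s)), (s ++ mkseq (shift c x) (L - size s)).
  split; [exact: leq_addr| |].
    by rewrite mem_words size_cat size_mkseq subnKC // ltnW.
  by exists i => z; rewrite mkseqD !prependA sP.
have [c1 _ [j1 P1]] := sP 0.
have ext c j : c1 < c -> cone_map (iter j f) (mkseq x c) s -> exists v, [/\ v <> [::],
    mkseq x c = mkseq x c1 ++ v, size v = c - c1 & forall z,
    iter j1 f (prepend (mkseq x c) z) = prepend s (prepend v z)].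
  move=> c1c P; exists (mkseq (shift c1 x) (c - c1)).
  split=> [|||z]; last 1 first.
  - by rewrite (mkseq_le x (ltnW c1c)) prependA P1.
  - by move/(congr1 size)/eqP; rewrite size_mkseq /= subn_eq0 leqNgt c1c.
  - exact/mkseq_le/ltnW.
  - by rewrite size_mkseq.
have x1 : iter j1 f x = prepend s (shift c1 x) by apply: cone_image.
have [[c [j [c1c P le_jj]]]|later] := pselect (exists c j,
    [/\ c1 < c, cone_map (iter j f) (mkseq x c) s & j <= j1]).
  have [v [vN0 vE _ vP]] := ext _ _ c1c P.
  have contr : cone_map (iter (j1 - j) f) s (s ++ v).
    by move=> z; rewrite -P -iterD subnK // vP prependA.
  move: le_jj; rewrite leq_eqVlt => /predU1P[ejj|lt_jj]; last first.
    by apply: (contracting_cone _ (cone_image P) contr); rewrite subn_gt0.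
  case: vN0; apply: prepend_fix_nil => z; apply: (@prepend_inj s).
  by have := contr z; rewrite ejj subnn prependA => <-.
have [c2 c12 [j2 P2]] := sP c1.+1; have [v [vN0 vE _ vP]] := ext _ _ c12 P2.
have ret c j : c1 < c -> cone_map (iter j f) (mkseq x c) s ->
    forall v, (forall z, iter j1 f (prepend (mkseq x c) z) = prepend s (prepend v z)) ->
    j1 < j /\ forall z, iter (j - j1) f (prepend s (prepend v z)) = prepend s z.
  move=> c1c P v' v'P; have jj : j1 < j.
    by rewrite ltnNge; apply/negP => le_jj; apply: later; exists c, j.
  by split=> // z; rewrite -v'P -iterD subnK 1?ltnW // P.
have [j12 ret2] := ret _ _ c12 P2 _ vP.
have [n nP] := iter_cone_nbhd x1.
right; exists n, j1, (j2 - j1), s, v; split=> //; first by rewrite subn_gt0.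
right; split=> [z|]; first by rewrite prependA.
rewrite x1; congr prepend; apply/esym.
have retp : iter (j2 - j1) f (prepend s (omega v)) = prepend s (omega v).
  by rewrite -{1}(omegaE vN0) ret2.
apply: agree_eq => m.
have [c c1c [j P]] := sP (c1.+1 + m).
have c1c' : c1 < c by apply: leq_trans c1c; rewrite leq_addr.
have [v' [v'N0 v'E sv' v'P]] := ext _ _ c1c' P.
have [j1j retv'] := ret _ _ c1c' P _ v'P.
have -> : omega v = prepend v' (omega v).
  apply/esym; apply: (@hyperbolic_periodic 0 (j2 - j1) s v vN0 _ (j2 - j1)).
  - by move=> z; rewrite ret2.
  - by rewrite subn_gt0.
  - by apply: (@iter_inj (j - j1)); rewrite iterC retv'.
have -> : shift c1 x = prepend v' (shift c x).
  apply: (@prepend_inj (mkseq x c1)); rewrite -prependA -v'E.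
  by rewrite !mkseq_shift.
apply: agree_le (@agree_prepend0 _ _ _); rewrite sv'.
by rewrite leq_subRL ?(ltnW c1c') // (leq_trans _ c1c) // leq_add2r.
Qed.

Lemma local_dynamicsP x : local_dynamics x.
Proof.
have [[c /regular_dynamics //]|/forallNP] := pselect (exists c, regular x c).
exact: irregular_dynamics.
Qed.

End Dynamics.

(** Nontriviality is asked of every iterate, so that importance does not change when [f] is replaced
    by a power. *)
Definition important f p := (exists2 l, 0 < l & iter l f p = p) /\
  forall l, 0 < l -> ~ locally_trivial (iter l f) p.

Lemma important_commute f g p : injective g -> (forall x, g (f x) = f (g x)) ->
  (forall n, exists m, forall x y, agree m x y -> agree n (g x) (g y)) ->
  important f p -> important f (g p).
Proof.
move=> g_inj gf gC [[l l0 fp] nt].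
have gfi j x : g (iter j f x) = iter j f (g x) by elim: j => //= j <-.
split=> [|j j0 [n triv]]; first by exists l; rewrite // -gfi fp.
apply: (nt j j0); have [m mP] := gC n; exists m => y /mP /triv.
by rewrite -gfi => /g_inj.
Qed.

Section Dynamics.
Variables (f : cantor_space -> cantor_space) (L : nat).
Hypothesis f_inj : injective f.
Hypothesis fL : forall u, size u = L -> exists w, cone_map f u w.
Implicit Types (x y z p q : cantor_space) (u v w s tau rho : seq bool).

Lemma important_iter n p : important f p -> important f (iter n f p).
Proof.
apply: important_commute; first exact: iter_inj.
  by move=> x; rewrite -iterS -iterSr.
by move=> m; apply: agree_iter fL n m.
Qed.

Lemma important_iter_inv n p l : 0 < l -> iter l f p = p ->
  important f (iter n f p) -> important f p.
Proof.
move=> l0 fp /(important_iter (l * n - n)).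
by rewrite -iterD subnK ?leq_pmull // (iter_mul_fix n fp).
Qed.

Lemma agree_iter_lt r n :
  exists m, forall j, j < r -> forall x y, agree m x y -> agree n (iter j f x) (iter j f y).
Proof.
elim: r => [|r [m mP]]; first by exists 0.
have [m' m'P] := agree_iter fL r n; exists (maxn m m') => j.
rewrite ltnS leq_eqVlt => /predU1P[->|lt_jr] x y h.
  by apply: m'P; apply: agree_le h; apply: leq_maxr.
by apply: mP => //; apply: agree_le h; apply: leq_maxl.
Qed.

Let periodic y := exists2 l, 0 < l & iter l f y = y.

(** The point [s] is only a candidate and may fail to be important. A finite cover by such cones
    bounds the number of important points and yields a common period. *)
Definition uniform_on u r (s : cantor_space) :=
  [/\ 0 < r,
      forall z l, 0 < l -> iter l f (prepend u z) = prepend u z ->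
        iter r f (prepend u z) = prepend u z /\
        (important f (prepend u z) \/ locally_trivial (iter r f) (prepend u z)) &
      forall z, important f (prepend u z) -> prepend u z = s].

Lemma hyperbolic_important a b r tau rho : rho <> [::] -> 0 < r ->
  (a = r /\ b = 0 \/ a = 0 /\ b = r) ->
  (forall z, iter a f (prepend tau z) = iter b f (prepend tau (prepend rho z))) ->
  iter r f (prepend tau (omega rho)) = prepend tau (omega rho) /\
  important f (prepend tau (omega rho)).
Proof.
move=> rhoN0 r0 ab hyp.
have rp : iter r f (prepend tau (omega rho)) = prepend tau (omega rho).
  by have := hyp (omega rho); rewrite omegaE //; case: ab => -[-> ->].
split=> //; split; first by exists r.
exact: hyperbolic_not_trivial hyp.
Qed.

(** In the hyperbolic case [n] steps carry every periodic point of the cone to the same point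
    [prepend tau (omega rho)]. Iterates are injective, so there is at most one such point, and it
    inherits the period and the importance of its image. *)
Lemma uniform_near x : exists c r (s : cantor_space), uniform_on (mkseq x c) r s.
Proof.
have nearP c z : agree c x (prepend (mkseq x c) z).
  by apply/agree_mkseq; rewrite -{3}[c](size_mkseq x) mkseq_prepend.
case: (local_dynamicsP f_inj fL x) => [[c [r [r0 rP]]]|[c [n [r [tau [rho [r0 rhoN0 CP H]]]]]]].
  have triv z : locally_trivial (iter r f) (prepend (mkseq x c) z).
    by exists c => y /(agree_trans (nearP c z)) /rP.
  exists c, r, x; split=> // [z l _ _|z [_ /(_ r r0 (triv z))] //].
  by split; [apply/rP/nearP|right; apply: triv].
have [a [b [ab hyp]]] : exists a b, (a = r /\ b = 0 \/ a = 0 /\ b = r) /\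
    forall z, iter a f (prepend tau z) = iter b f (prepend tau (prepend rho z)).
  case: H => [h|[h _]]; [exists r, 0|exists 0, r]; split; try by [left|right].
    by move=> z; rewrite h prependA.
  by move=> z; rewrite -prependA h.
have [rp imp_p] := hyperbolic_important rhoN0 r0 ab hyp.
have per z l : 0 < l -> iter l f (prepend (mkseq x c) z) = prepend (mkseq x c) z ->
    iter n f (prepend (mkseq x c) z) = prepend tau (omega rho).
  move=> l0 lz; have [z' e] := CP _ (nearP c z); rewrite e; congr prepend.
  by apply: (hyperbolic_periodic f_inj rhoN0 hyp l0); rewrite -e iterC lz.
exists c, r.
have [[s [[z ->] sI]]|none] := pselect (exists s : cantor_space, (exists z, s = prepend (mkseq x c) z) /\ important f s).
  exists (prepend (mkseq x c) z); split=> // [z' l l0 lz|z' imp'].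
    have e := per _ _ l0 lz; split; first by apply: (@iter_inj _ f_inj n); rewrite iterC e rp.
    by left; apply: (@important_iter_inv n _ l) => //; rewrite e.
  case: sI => [[l l0 lz] _]; case: imp' => [[l' l'0 lz'] _].
  by apply: (@iter_inj _ f_inj n); rewrite (per _ _ l0 lz) (per _ _ l'0 lz').
exists x; split=> // [z l l0 lz|z imp]; last by case: none; exists (prepend (mkseq x c) z); split=> //; exists z.
have e := per _ _ l0 lz; split; first by apply: (@iter_inj _ f_inj n); rewrite iterC e rp.
by left; apply: (@important_iter_inv n _ l) => //; rewrite e.
Qed.

(** The first alternative is the repelling case, with [p = x]: no orbit is controlled there, but the
    whole cone is close to an important point. *)
Lemma attraction_near n x : exists c, (exists2 p, important f p & agree n p x /\ n <= c) \/
  exists T0, forall y, agree c x y -> periodic y \/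
    forall T, T0 <= T -> exists2 p, important f p & agree n p (iter T f y).
Proof.
case: (local_dynamicsP f_inj fL x) => [[c [r [r0 rP]]]|[c [k [r [tau [rho [r0 rhoN0 CP H]]]]]]].
  by exists c; right; exists 0 => y /rP; left; exists r.
case: H => [h|[h xk]].
  have hyp z : iter r f (prepend tau z) = iter 0 f (prepend tau (prepend rho z)).
    by rewrite h prependA.
  have [rp imp_p] := hyperbolic_important rhoN0 r0 (or_introl (conj erefl erefl)) hyp.
  have [m mP] := agree_iter_lt r n.
  (* After [k] steps the point is in the cone [tau], [m] further contractions bring it to depth [m]
     of the attracting point, and [m] was chosen so that the fewer than [r] remaining steps keep
     agreement to depth [n]. *)
  exists c; right; exists (k + r * m) => y /CP [z yE]; right => T leT.
  exists (iter ((T - k) %% r) f (prepend tau (omega rho))); first exact: important_iter.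
  have kT : k <= T by apply: leq_trans leT; apply: leq_addr.
  have -> : iter T f y = iter ((T - k) %% r) f (iter (r * ((T - k) %/ r)) f (iter k f y)).
    by rewrite -!iterD; congr iter; rewrite [_ + r * _]addnC mulnC -divn_eq subnK.
  apply: mP; first by rewrite ltn_mod.
  rewrite yE (hyperbolic_iter hyp) mul0n /=.
  rewrite -(omega_wpow ((T - k) %/ r) rhoN0) -!prependA.
  apply: agree_le (@agree_prepend0 _ _ _); rewrite size_cat size_wpow.
  apply: leq_trans (leq_addl _ _); apply: (@leq_trans ((T - k) %/ r)).
    by rewrite leq_divRL // mulnC leq_subRL.
  by rewrite leq_pmulr //; case: (rho) rhoN0.
have hyp z : iter 0 f (prepend tau z) = iter r f (prepend tau (prepend rho z)).
  by rewrite -prependA h.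
have [rp imp_p] := hyperbolic_important rhoN0 r0 (or_intror (conj erefl erefl)) hyp.
exists n; left; exists x => //; apply: (@important_iter_inv k _ r) => //; last by rewrite xk.
by apply: (@iter_inj _ f_inj k); rewrite iterC xk.
Qed.

Theorem dynamics : exists (S : seq cantor_space) k,
  [/\ 0 < k, forall p, p \in S <-> important f p,
      forall y, periodic y -> iter k f y = y /\ (y \in S \/ locally_trivial (iter k f) y) &
      forall n, exists T0, forall T y, T0 <= T -> [\/ periodic y,
        exists2 p, p \in S & agree n p y | exists2 p, p \in S & agree n p (iter T f y)]].
Proof.
have [|E [EQ EP]] := @cantor_cover (fun u => exists r (s : cantor_space), uniform_on u r s).
  by move=> x; have [c h] := uniform_near x; exists c.
have /choice[r rP] u : exists r, u \in E -> exists s : cantor_space, uniform_on u r s.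
  by have [/EQ [r h]|uE] := boolP (u \in E); [exists r|exists 0].
have /choice[s sP] u : exists s : cantor_space, u \in E -> uniform_on u (r u) s.
  by have [/rP [s h]|uE] := boolP (u \in E); [exists s|exists (omega [::])].
pose S := [seq s u | u <- E & `[< important f (s u) >]].
have SP p : p \in S <-> important f p.
  split=> [/mapP[u]|imp].
    by rewrite mem_filter => /andP[/asboolP imp _ ->].
  have [u uE [z pE]] := EP p; have [_ _ /(_ z)] := sP u uE; rewrite -pE => /(_ imp) ps.
  by rewrite ps; apply: map_f; rewrite mem_filter uE -ps andbT; apply/asboolP.
exists S, (\prod_(u <- E) r u); split=> //.
- by rewrite big_seq; apply: prodn_cond_gt0 => u /sP [].
- move=> y [l l0 ly]; have [u uE [z yE]] := EP y; have [r0 uP _] := sP u uE.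
  have -> : \prod_(v <- E) r v = r u * \prod_(v <- rem u E) r v by rewrite (big_rem u).
  have [] := uP z l l0; rewrite -yE // => ry H; split; first exact: iter_mul_fix.
  case: H => [/SP|[n triv]]; first by left.
  by right; exists n => y' /triv; apply: iter_mul_fix.
move=> n; pose Q u := (forall z, exists2 p, important f p & agree n p (prepend u z)) \/
  exists T0, forall z, periodic (prepend u z) \/
    forall T, T0 <= T -> exists2 p, important f p & agree n p (iter T f (prepend u z)).
have [|F [FQ FP]] := @cantor_cover Q.
  move=> x; have [c cP] := attraction_near n x; exists c.
  have nearP z : agree c x (prepend (mkseq x c) z).
    by apply/agree_mkseq; rewrite -{3}[c](size_mkseq x) mkseq_prepend.
  case: cP => [[p imp [px nc]]|[T0 T0P]]; [left=> z; exists p => //|right; exists T0 => z].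
    exact: agree_trans px (agree_le nc (nearP z)).
  exact: T0P.
have /choice[T TP] u : exists T, u \in F ->
  (forall z, exists2 p, important f p & agree n p (prepend u z)) \/
  forall z, periodic (prepend u z) \/
    forall T', T <= T' -> exists2 p, important f p & agree n p (iter T' f (prepend u z)).
  have [/FQ [h|[T h]]|uF] := boolP (u \in F); last by exists 0.
    by exists 0; left.
  by exists T; right.
exists (\max_(u <- F) T u) => T' y leT; have [u uF [z yE]] := FP y.
case: (TP u uF) => [/(_ z)|/(_ z)]; rewrite -yE.
  by case=> p /SP pS h; apply: Or32; exists p.
case=> [|h]; first by apply: Or31.
have [|p /SP pS h'] := h T'; last by apply: Or33; exists p.
by apply: leq_trans leT; apply: leq_bigmax_seq.
Qed.

End Dynamics.

(** * Elements of Thompson's group V and their germs *)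

Local Open Scope classical_set_scope.

Lemma nbhs_agree n (x : cantor_space) : nbhs x [set y | agree n x y].
Proof.
elim: n => [|n IHn]; first by apply: filterS filterT => y _ i.
have xn : nbhs x [set y : cantor_space | y n = x n].
  have /(_ x) := @proj_continuous _ (fun _ : nat => bool : topologicalType) n.
  by move/(_ [set b | b = x n]); apply; rewrite nbhs_principalE.
apply: filterS2 IHn xn => y /= h e i; rewrite ltnS leq_eqVlt => /predU1P[->|] //.
exact: h.
Qed.

(** The product topology is the supremum of the topologies induced by the coordinates, so one
    coordinate is treated at a time; coordinate [i] is decided by agreement to depth [i.+1]. *)
Lemma cantor_continuous (f : cantor_space -> cantor_space) :
  (forall n x, exists m, forall y, agree m x y -> agree n (f x) (f y)) -> continuous f.
Proof.
move=> fC x; apply/cvg_sup => i; apply/cvg_image => //.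
  by rewrite eqEsubset; split=> // b _; exists (fun=> b).
move=> W /=; rewrite nbhs_principalE => Wx.
have [m mP] := fC i.+1 x.
exists ((fun y : cantor_space => y i) @^-1` W); last first.
  by rewrite image_preimage // eqEsubset; split=> // b _; exists (fun=> b).
apply: filterS (nbhs_agree m x) => y /= /mP /(_ i (ltnSn i)) <-.
exact: Wx.
Qed.

Lemma prefix_replacement_cone f : prefix_replacement f ->
  exists L, forall u, size u = L -> exists w, cone_map f u w.
Proof.
move=> [t [tP _ ft]]; exists (\max_(p <- t) size p.1) => u uL.
have z : cantor_space := fun=> false.
have: has (is_prefix^~ (prepend u z)) (unzip1 t) by rewrite has_count tP.
case/hasP=> _ /mapP[[u' w] uwt ->] /is_prefixP[z' /esym e].
have [v uE] : exists v, u = u' ++ v.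
  by apply: prepend_eq_prefix e; rewrite uL (big_rem _ uwt) /= leq_maxl.
by exists (w ++ v) => y; rewrite uE !prependA (ft _ _ uwt).
Qed.

Lemma prefix_replacement_inv f g : cancel f g -> cancel g f ->
  prefix_replacement f -> prefix_replacement g.
Proof.
move=> fK gK [t [tP t'P ft]]; exists [seq (p.2, p.1) | p <- t].
rewrite /unzip1 /unzip2 -!map_comp; split=> // u w /mapP[[u' w'] uwt [-> ->]] z.
by rewrite -(ft _ _ uwt) fK.
Qed.

Lemma words_uniq n : uniq (words n).
Proof. by rewrite /words map_inj_uniq ?enum_uniq //; apply: val_inj. Qed.

Lemma words_complete n : complete_prefix_code (words n).
Proof.
move=> z; rewrite (@eq_in_count _ _ (pred1 (mkseq z n))) => [|u].
  by rewrite count_uniq_mem ?words_uniq // mem_words size_mkseq eqxx.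
by rewrite mem_words => /eqP un /=; rewrite /is_prefix un.
Qed.

(** Continuity is automatic: the inverse of a prefix replacement is again one, so both maps send
    long agreement to long agreement. *)
Lemma in_V f g L : cancel f g -> cancel g f ->
  (forall u, size u = L -> exists w, cone_map f u w) ->
  homeomorphism f /\ prefix_replacement f.
Proof.
move=> fK gK fL.
have fP : prefix_replacement f.
  have /choice[h hP] u : exists w, size u = L -> cone_map f u w.
    by have [/fL[w]|uL] := pselect (size u = L); [exists w|exists [::]].
  apply: (@prefix_replacement_of_domain f g [seq (u, h u) | u <- words L]) => //.
    by rewrite /unzip1 -map_comp map_id; apply: words_complete.
  by move=> u w /mapP[u']; rewrite mem_words => /eqP u'L [-> ->]; apply: hP.
have [L' gL] := prefix_replacement_cone (prefix_replacement_inv fK gK fP).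
split=> //; exists g; split=> //; apply: cantor_continuous => n x.
  by exists (L + n) => y; apply: agree_f.
by exists (L' + n) => y; apply: agree_f.
Qed.

Section GroupV.
Local Open Scope group_scope.
Implicit Types (f g h : thompson_V) (p x : cantor_space).

Lemma V_cone f : exists L, forall u, size u = L -> exists w, cone_map (val f) u w.
Proof. by case: (asboolW (valP f)) => _ /prefix_replacement_cone. Qed.

Lemma val_VM f g x : val (f * g) x = val f (val g x).
Proof. by []. Qed.

Lemma val_V1 x : val (1 : thompson_V) x = x.
Proof. by []. Qed.

Lemma val_VK f : cancel (val f) (val f^-1).
Proof. by move=> x; rewrite -val_VM mulVg. Qed.

Lemma val_V_inj f : injective (val f).
Proof. exact: can_inj (val_VK f). Qed.

Lemma val_VX f n x : val (f ^+ n) x = iter n (val f) x.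
Proof. by elim: n => // n IHn; rewrite expgS val_VM IHn. Qed.

Lemma V_ext f g : (forall x, val f x = val g x) -> f = g.
Proof. by move=> fg; apply/val_inj/functional_extensionality_dep. Qed.

(* The germ of [f] at [p] replaces long prefixes of length [n + a] by prefixes of length
   [n + b]; it is determined by [b - a], which two naturals encode without subtraction. *)
Definition germ f p a b :=
  exists N, forall n, N <= n -> cone_map (val f) (mkseq p (n + a)) (mkseq p (n + b)).

Lemma germ_exists f p : val f p = p -> exists a b, germ f p a b.
Proof.
move=> fp; have [L fL] := V_cone f; have [w wP] := fL _ (size_mkseq p L).
(* As [p] is fixed, the replacing word is itself a prefix of [p], and the tails of [p] after [L] and
   after [size w] letters coincide. *)
have wE : w = mkseq p (size w) by rewrite -{1}fp (cone_image wP) mkseq_prepend.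
exists L, (size w), 0 => n _ z.
rewrite addnC [n + size w]addnC !mkseqD -wE !prependA wP; congr (prepend w (prepend _ _)).
apply: (@eq_from_nth _ false); rewrite !size_mkseq // => i lt_i; rewrite !nth_mkseq // /shift.
have := congr1 (fun y : cantor_space => y (size w + i)) (cone_image wP).
by rewrite fp prepend_shift /shift => ->.
Qed.

Lemma germM f g p a b a' b' : germ f p a b -> germ g p a' b' -> germ (f * g) p (a + a') (b + b').
Proof.
move=> [N fN] [N' gN]; exists (maxn N N') => n; rewrite geq_max => /andP[Nn N'n] z.
rewrite val_VM [in a + a']addnC !addnA [n + a' + a]addnAC gN ?(leq_trans N'n) ?leq_addr //.
by rewrite [n + a + b']addnAC fN ?(leq_trans Nn) ?leq_addr // addnAC.
Qed.

Lemma germV f p a b : germ f p a b -> germ f^-1 p b a.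
Proof. by move=> [N fN]; exists N => n /fN h z; rewrite -h val_VK. Qed.

Lemma germX f p a b k : germ f p a b -> germ (f ^+ k) p (k * a) (k * b).
Proof.
move=> fp; elim: k => [|k IHk]; first by exists 0 => n _ z; rewrite !mul0n.
by rewrite expgS !mulSn; apply: germM.
Qed.

Lemma germ_trivial f p a : germ f p a a -> locally_trivial (val f) p.
Proof. by move=> [N fN]; exists (N + a) => y /agreeP ->; apply: fN. Qed.

(** Exponents of germs add up, and those of a commutator cancel: both totals equal
    [a + a' + b + b']. *)
Lemma germ_commutator f g p : val f p = p -> val g p = p ->
  locally_trivial (val (f * g * f^-1 * g^-1)) p.
Proof.
move=> /germ_exists[a [b fp]] /germ_exists[a' [b' gp]].
apply: (@germ_trivial _ _ (a + a' + b + b')).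
suff {2}-> : a + a' + b + b' = b + b' + a + a' by exact: germM (germM (germM fp gp) (germV fp)) (germV gp).
by rewrite -addnA addnC addnA.
Qed.

End GroupV.

Local Close Scope classical_set_scope.

(** * The dynamical obstruction *)

Local Open Scope group_scope.

Lemma count_lt (T : eqType) (a b : pred T) (s : seq T) x :
  subpred a b -> x \in s -> b x -> ~~ a x -> count a s < count b s.
Proof.
move=> ab + bx ax; elim: s => //= y s IHs; rewrite inE => /predU1P[<-|/IHs lt_s].
  by rewrite bx (negPf ax) add0n add1n ltnS; apply: sub_count.
by rewrite -addnS leq_add //; case: (boolP (a y)) => // /ab ->.
Qed.

Section Core.
Variables (F : groupType) (act : F -> cantor_space -> cantor_space).
Variables (A : F -> Prop) (P : seq cantor_space) (g0 c : F).
Implicit Types (x y p q : cantor_space) (u w g h a b d : F) (n : nat).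

Let near n x := exists2 p, p \in P & agree n p x.
Let trivial_at u p := locally_trivial (act u) p.

Hypothesis act1 : forall x, act 1 x = x.
Hypothesis actM : forall g h x, act (g * h) x = act g (act h x).
Hypothesis act_cont : forall g n, exists m,
  forall x y, agree m x y -> agree n (act g x) (act g y).
Hypothesis AM : forall a b, A a -> A b -> A (a * b).
Hypothesis AV : forall a, A a -> A a^-1.
Hypothesis Aab : forall a b, A a -> A b -> a * b = b * a.
Hypothesis malnormal : forall u a, A a -> a <> 1 -> A (u * a * u^-1) -> A u.
(** Phrased through the action, since faithfulness is assumed only on [A]. *)
Hypothesis conj_commute : forall u g, A g -> g <> 1 ->
  (forall x, act (u * (g * u * g^-1)) x = act (g * u * g^-1 * u) x) -> A u.
Hypothesis A_faithful : forall a, A a -> (forall x, act a x = x) -> a = 1.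
Hypotheses (Ac : ~ A c) (Ag0 : A g0) (g0N1 : g0 <> 1).
Hypothesis A_fix : forall a p, A a -> p \in P -> act a p = p.
Hypothesis germ_kernel : forall p, p \in P -> exists d, [/\ A d, d <> 1 & trivial_at d p].
Hypothesis germ_abelian : forall p g h, p \in P -> act g p = p -> act h p = p ->
  trivial_at (g * h * g^-1 * h^-1) p.
Hypothesis neutral : forall x a, x \notin P -> (forall a, A a -> act a x = x) ->
  A a -> trivial_at a x.
(** A single [g] serves all moved points at once; only so can it displace a whole support. *)
Hypothesis contract : forall n, exists g, [/\ A g, g <> 1 &
  forall x a, A a -> act a x <> x -> ~ near n x -> near n (act g x)].

Lemma actK g x : act g^-1 (act g x) = x.
Proof. by rewrite -actM mulVg act1. Qed.

Lemma actKV g x : act g (act g^-1 x) = x.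
Proof. by rewrite -actM mulgV act1. Qed.

Lemma act_inj g x y : act g x = act g y -> x = y.
Proof. by move/(congr1 (act g^-1)); rewrite !actK. Qed.

Lemma A1 : A 1.
Proof. by rewrite -(mulgV g0); apply: AM => //; apply: AV. Qed.

Lemma AMl a u : A a -> A (a * u) -> A u.
Proof. by move=> Aa Aau; rewrite -(mulKg a u); apply: AM => //; apply: AV. Qed.

Lemma AMr a u : A a -> A (u * a) -> A u.
Proof. by move=> Aa Aau; rewrite -(mulgK a u); apply: AM => //; apply: AV. Qed.

Lemma AVr u : A u^-1 -> A u.
Proof. by move=> /AV; rewrite invgK. Qed.

Lemma AJ a u : A a -> A (a * u * a^-1) -> A u.
Proof. by move=> Aa /(AMr (AV Aa)) /(AMl Aa). Qed.

Lemma trivial_atM g h p : trivial_at g p -> trivial_at h p -> trivial_at (g * h) p.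
Proof.
move=> [m mP] [n nP]; exists (maxn m n) => y py.
rewrite actM nP ?mP //; [apply: agree_le py|apply: agree_le py].
  exact: leq_maxl.
exact: leq_maxr.
Qed.

Lemma trivial_atV g p : trivial_at g p -> trivial_at g^-1 p.
Proof. by move=> [m mP]; exists m => y /mP e; rewrite -{1}e actK. Qed.

Lemma trivial_atJ h g p : trivial_at g (act h p) -> trivial_at (h^-1 * g * h) p.
Proof.
move=> [n nP]; have [m mP] := act_cont h n; exists m => y /mP /nP e.
by rewrite !actM e actK.
Qed.

Lemma trivial_at_open g p : trivial_at g p ->
  exists n, forall y, agree n p y -> trivial_at g y.
Proof.
move=> [n nP]; exists n => y py; exists n => z yz.
exact/nP/(agree_trans py yz).
Qed.

Lemma near_le m n x : m <= n -> near n x -> near m x.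
Proof. by move=> mn [p pP px]; exists p => //; apply: agree_le px. Qed.

Section Stage1.
Variable Q : seq cantor_space.
Hypothesis QP : {subset Q <= P}.
(** [Q] is the part of [P] already dealt with. [T p] says that [p] obstructs the next step: nothing
    outside [A] is trivial near both [Q] and [p]. [N p q] says that the images of [p] under [R] come
    arbitrarily close to another point [q] of [P]. *)
Let R u := forall q, q \in Q -> trivial_at u q.
Let T p := p \in P /\ forall u, R u -> trivial_at u p -> A u.
Let N p q := [/\ q \in P, q <> p & forall n, exists2 u, R u & agree n q (act u p)].

Lemma RM u w : R u -> R w -> R (u * w).
Proof. by move=> Ru Rw q qQ; apply: trivial_atM; [apply: Ru|apply: Rw]. Qed.

Lemma RV u : R u -> R u^-1.
Proof. by move=> Ru q /Ru /trivial_atV. Qed.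

Lemma RJ a u : A a -> R u -> R (a * u * a^-1).
Proof.
move=> Aa Ru q qQ; rewrite -[a in a * u](invgK a); apply: trivial_atJ.
by rewrite A_fix; [apply: Ru|apply: AV|apply: QP].
Qed.

(* Otherwise [u^-1 d u d^-1] lies in [R] and is trivial at [p], hence lies in [A]. *)
Lemma moved_nontrivial p u d : T p -> R u -> ~ A u -> A d -> d <> 1 -> trivial_at d p ->
  ~ trivial_at d (act u p).
Proof.
move=> [_ Tp] Ru nAu Ad dN1 dp dup; apply: nAu; apply: AVr.
apply: (malnormal Ad dN1); rewrite invgK; apply: (AMr (AV Ad)); apply: Tp.
  rewrite -!mulgA [d * _]mulgA; apply: RM; first exact: RV.
  exact: RJ.
by apply: trivial_atM; [apply: trivial_atJ|apply: trivial_atV].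
Qed.

(* If [u p] is fixed by [A], then [u^-1 g0 u] and [g0] both fix [p], so their commutator,
   which lies in [R], is trivial at [p]. *)
Lemma moved_notin p u : T p -> R u -> ~ A u -> act u p \notin P.
Proof.
move=> [pP Tp] Ru nAu; apply/negP => upP; apply: nAu.
pose x := u^-1 * g0 * u.
have xp : act x p = p by rewrite !actM (A_fix Ag0 upP) actK.
have triv := germ_abelian pP xp (A_fix Ag0 pP).
have e : x * g0 * x^-1 * g0^-1 = (u^-1 * (g0 * u * g0^-1)) * (g0 * (u^-1 * (g0 * u * g0^-1))^-1 * g0^-1).
  by rewrite /x !invgM !invgK !mulgA !mulgVK.
have Rr : R (u^-1 * (g0 * u * g0^-1)) by apply: RM; [apply: RV|apply: RJ].
have /(AMr (AV Ag0)) /(malnormal Ag0 g0N1) Ax : A (x * g0 * x^-1 * g0^-1).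
  by apply: (Tp _ _ triv); rewrite e; apply: RM => //; apply: RJ => //; apply: RV.
by apply/AVr/(malnormal Ag0 g0N1); rewrite invgK.
Qed.

(** By [moved_nontrivial] and [neutral] the point [u p] is moved by [A], so some [g] in [A] pushes
    it close to [P]; as [g] fixes [p], the pushed point is the image of [p] under [g u g^-1], again
    in [R] and outside [A]. The limit [q] differs from [p] because [d] is trivial near [p] but not
    at such images. *)
Lemma N_nonempty p : T p -> (exists2 u, R u & ~ A u) -> exists q, N p q.
Proof.
move=> Tp [u Ru nAu]; have [pP _] := Tp; have [d [Ad dN1 dp]] := germ_kernel pP.
have [a [Aa aup]] : exists a, A a /\ act a (act u p) <> act u p.
  apply: contrapT => /forallNP h; apply: (moved_nontrivial Tp Ru nAu Ad dN1 dp).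
  apply: neutral Ad; first exact: moved_notin.
  by move=> a Aa; apply: contrapT => aup; apply: (h a).
have rn n : exists w, [/\ R w, ~ A w & near n (act w p)].
  have [ne|nne] := pselect (near n (act u p)); first by exists u.
  have [g [Ag _ gP]] := contract n; exists (g * u * g^-1); split.
  - exact: RJ.
  - by move/(AJ Ag).
  - by rewrite !actM (A_fix (AV Ag) pP); apply: gP Aa aup nne.
have [q qP qN] : exists2 q, q \in P & forall m, exists2 n, m <= n &
    exists w, [/\ R w, ~ A w & agree n q (act w p)].
  apply: pigeonhole => n; have [w [Rw nAw [q qP qw]]] := rn n.
  by exists n, q; split=> //; exists w.
exists q; split=> // [qp|n]; last first.
  by have [m nm [w [Rw _ wq]]] := qN n; exists w => //; apply: agree_le wq.
have [m mP] := trivial_at_open dp; have [n mn [w [Rw nAw wq]]] := qN m.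
by apply: (moved_nontrivial Tp Rw nAw Ad dN1 dp); apply: mP; rewrite -{1}qp; apply: agree_le wq.
Qed.

Lemma A_fixT p u : p \in P -> act u p <> p -> ~ A u.
Proof. by move=> pP up /A_fix /(_ pP). Qed.

(** Let [w] in [R] be trivial near [q], and let [u p], [u' p] be distinct images close to [q]. The
    conjugates of [w] by [u^-1] and [u'^-1] are trivial at [p], hence lie in [A]. If [w <> 1],
    malnormality puts [u'^-1 u] into [A], so it fixes [p], and [u p = u' p]. *)
Lemma N_closed p q : T p -> N p q -> T q.
Proof.
move=> Tp [qP qp qN]; have [pP Tp'] := Tp; split=> // w Rw wq.
apply: contrapT => nAw; have wN1 : w <> 1 by move=> w1; apply: nAw; rewrite w1; apply: A1.
have [m mP] := trivial_at_open wq.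
have get k x : x <> q -> exists u, [/\ R u, agree k q (act u p) & act u p <> x].
  move=> xq; have [k' nk'] := disagree xq.
  have [u Ru qu] := qN (maxn k k'); exists u; split=> //.
    by apply: agree_le qu; apply: leq_maxl.
  by move=> e; apply/nk'/agree_sym; rewrite -e; apply: agree_le qu; apply: leq_maxr.
have [u [Ru qu up]] := get m p (nesym qp).
have nAu := A_fixT pP up.
have upq : act u p <> q by move=> e; have := moved_notin Tp Ru nAu; rewrite e qP.
have [u' [Ru' qu' u'u]] := get m _ upq.
have inA v : R v -> agree m q (act v p) -> A (v^-1 * w * v).
  move=> Rv /mP wv; apply: Tp'; last exact: trivial_atJ.
  exact: (RM (RM (RV Rv) Rw) Rv).
apply: u'u; suff Auu : A (u'^-1 * u).
  by rewrite -[RHS](actKV u') -[act u'^-1 _]actM (A_fix Auu pP).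
apply: (@malnormal _ (u^-1 * w * u)); first exact: inA.
  by move/(congr1 (fun z => u * z * u^-1)); rewrite /= mulg1 mulgV !mulgA mulgV mul1g mulgK => /wN1.
have := inA _ Ru' qu'; congr A.
by rewrite invgM invgK !mulgA !mulgK.
Qed.

(** The point is that [s <> p]. If [w] brings [q] close to [p] and [u] brings [p] close to [q], then
    [w u p] is so close to [p] that [w u] lies in [A] and fixes [p]. Thus [u p = w^-1 p] for all
    such [u], which forces [w^-1 p = q], and then [w q = p] contradicts [moved_notin]. *)
Lemma N_trans p q s : T p -> N p q -> N q s -> N p s.
Proof.
move=> Tp Npq [sP sq sN]; have Tq := N_closed Tp Npq; have [qP qp qN] := Npq.
have [pP _] := Tp; split=> // [e|n]; last first.
  have [w Rw ws] := sN n; have [m mP] := act_cont w n.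
  have [u Ru uq] := qN m; exists (w * u); first exact: RM.
  by rewrite actM; apply: agree_trans ws (mP _ _ uq).
rewrite {}e {s} in sP sq sN.
have [d [Ad dN1 dp]] := germ_kernel pP; have [n nP] := trivial_at_open dp.
have [n' pq] := disagree sq; have [w Rw ws] := sN (maxn n n').
have nAw : ~ A w.
  by move=> Aw; apply: pq; rewrite A_fix // in ws; apply: agree_le ws; apply: leq_maxr.
have [m mP] := act_cont w n.
have wq k : agree k q (act w^-1 p).
  have [u Ru uq] := qN (maxn m k).
  have Awu : A (w * u).
    apply: contrapT => nAwu.
    apply: (moved_nontrivial Tp (RM Rw Ru) nAwu Ad dN1 dp); apply: nP.
    rewrite actM; apply: (agree_trans (agree_le (leq_maxl n n') ws)).
    by apply: mP; apply: agree_le uq; apply: leq_maxl.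
  have := A_fix Awu pP; rewrite actM => /(congr1 (act w^-1)); rewrite actK => <-.
  by apply: agree_le uq; apply: leq_maxr.
have := moved_notin Tq Rw nAw.
by rewrite (agree_eq wq) actKV pP.
Qed.

(* [N] is transitive, irreflexive and serial on the points satisfying [T], of which
   there are finitely many. *)
Lemma T_empty p : (exists2 u, R u & ~ A u) -> ~ T p.
Proof.
move=> RA Tp; have [n] := ubnP (count (fun q => `[< N p q >]) P).
elim: n p Tp => // n IHn p Tp le_n; have [q Npq] := N_nonempty Tp RA.
apply: (IHn q); first exact: N_closed Npq.
rewrite -ltnS; apply: leq_trans le_n; rewrite ltnS.
have sub : subpred (fun s => `[< N q s >]) (fun s => `[< N p s >]).
  by move=> s /asboolP Nqs; apply/asboolP; apply: N_trans Nqs.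
have [qP _ _] := Npq; apply: (count_lt sub qP); first exact/asboolP.
by apply/asboolP => -[_ /(_ erefl)].
Qed.

End Stage1.

(** Induction on [Q]: if [p :: Q] admits no such element, then [T p] holds relative to [Q], against
    [T_empty]. *)
Lemma trivial_on (Q : seq cantor_space) : {subset Q <= P} ->
  exists2 u, ~ A u & forall q, q \in Q -> trivial_at u q.
Proof.
elim: Q => [|p Q IHQ] QP; first by exists c.
have QP' : {subset Q <= P} by move=> q qQ; apply: QP; rewrite inE qQ orbT.
have [u nAu uQ] := IHQ QP'; apply: contrapT => /forall2NP h.
apply: (@T_empty Q QP' p); first by exists u.
split=> [|w wQ wp]; first by apply: QP; rewrite mem_head.
by have [/contrapT //|[]] := h w; move=> q; rewrite inE => /predU1P[->|/wQ].
Qed.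

Let fixA x := forall a, A a -> act a x = x.

Lemma moved_by_A x : ~ fixA x -> exists2 a, A a & act a x <> x.
Proof. by move=> /existsNP[a /not_implyP[Aa ax]]; exists a. Qed.

Lemma common_nbhd u : (forall p, p \in P -> trivial_at u p) ->
  exists n, forall x, near n x -> act u x = x.
Proof.
move=> uP; have : {subset P <= P} by [].
suff H (Q : seq cantor_space) : {subset Q <= P} -> exists n, forall x, (exists2 p, p \in Q & agree n p x) -> act u x = x.
  exact: H.
elim: Q => [|p Q IHQ] QP; first by exists 0 => x [].
have [|n nP] := IHQ; first by move=> q qQ; apply: QP; rewrite inE qQ orbT.
have [m mP] : trivial_at u p by apply/uP/QP; rewrite mem_head.
exists (maxn m n) => x [q]; rewrite inE => /predU1P[->|qQ] qx.
  by apply: mP; apply: agree_le qx; apply: leq_maxl.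
by apply: nP; exists q => //; apply: agree_le qx; apply: leq_maxr.
Qed.

(* Take [u] outside [A] trivial near [P]. Then [v = u^-1 (g0 u g0^-1)] is trivial at the
   fixed points of [A] that [u] maps to fixed points of [A]. Conjugating [v] by
   [(g u^-1 g^-1) u], where [g] pushes the other images under [u] close to [P], makes it
   trivial at all of them. *)
Lemma trivial_on_fixed : exists u, [/\ u <> 1, forall p, p \in P -> trivial_at u p &
  forall x, fixA x -> act u x = x].
Proof.
have [u nAu uP] := @trivial_on P (fun p => id).
have uJ a : A a -> forall p, p \in P -> trivial_at (a * u * a^-1) p.
  by move=> Aa; apply: RJ.
pose v := u^-1 * (g0 * u * g0^-1).
have vP p : p \in P -> trivial_at v p.
  by move=> pP; apply: trivial_atM; [apply/trivial_atV/uP|apply: uJ].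
have vN1 : v <> 1.
  move=> v1; apply: nAu; apply: (malnormal Ag0 g0N1).
  have e : g0 * u * g0^-1 = u by rewrite -[LHS](mulVKg u) -/v v1 mulg1.
  suff -> : u * g0 * u^-1 = g0 by [].
  by rewrite -{1}e mulgVK mulgK.
have [n nu] := common_nbhd uP; have [m mv] := common_nbhd vP.
have [g [Ag _ gP]] := contract (maxn n m).
pose r := g * u^-1 * g^-1 * u.
have rP p : p \in P -> trivial_at r p.
  move=> pP; apply: trivial_atM; last exact: uP.
  have -> : g * u^-1 * g^-1 = (g * u * g^-1)^-1 by rewrite !invgM invgK mulgA.
  by apply/trivial_atV/uJ.
exists (r * v * r^-1); split=> [e|p pP|x xA].
- by apply: vN1; apply: (@mulgI _ r); rewrite mulg1; apply: divg1_eq.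
- by apply: trivial_atM; [apply: trivial_atM; [exact: rP|exact: vP]|apply/trivial_atV/rP].
suff vr : act v (act r^-1 x) = act r^-1 x by rewrite (actM (r * v)) (actM r) vr actKV.
have rVx : act r^-1 x = act u^-1 (act g (act u x)).
  by rewrite /r !invgM !invgK !mulgA !actM (xA _ (AV Ag)).
have [uxA|/moved_by_A [a Aa aux]] := pselect (fixA (act u x)).
  rewrite rVx (uxA g Ag) actK /v !actM (xA _ (AV Ag0)) (uxA g0 Ag0).
  exact: actK.
have xfar : ~ near n (act u x).
  by move=> /nu /act_inj ux; rewrite ux in aux; apply/aux/xA.
have gux : near (maxn n m) (act g (act u x)).
  apply: gP Aa aux _ => /near_le; apply: contra_not xfar => h.
  by apply: h; apply: leq_maxl.
have e : act u^-1 (act g (act u x)) = act g (act u x).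
  by apply: (@act_inj u); rewrite actKV (nu _ (near_le (leq_maxl n m) gux)).
by rewrite rVx e (mv _ (near_le (leq_maxr n m) gux)).
Qed.

(* [g] pushes the support of [u] into a neighbourhood of [P] where [u] is trivial, so [u]
   and [g u g^-1] commute. *)
Theorem no_action : False.
Proof.
have [u [uN1 uP uA]] := trivial_on_fixed.
have [n nu] := common_nbhd uP; have [g [Ag gN1 gP]] := contract n.
have supp x : act u x <> x -> near n (act g x) /\ ~ near n x.
  move=> ux; have [/uA //|/moved_by_A [a Aa ax]] := pselect (fixA x).
  have xn : ~ near n x by move/nu.
  by split=> //; apply: gP ax xn.
have uu x : act u (act u x) <> act u x -> act u x <> x by move=> h e; apply: h; rewrite e.
apply: uN1; have Au : A u.
  apply: (@conj_commute u g Ag gN1) => x.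
  rewrite !actM; pose y := act g^-1 x.
  have xE : x = act g y by rewrite actKV.
  rewrite -/y; have [uy|uy] := pselect (act u y = y).
    rewrite uy -xE; have [->|ux] := pselect (act u x = x); first by rewrite -/y uy.
    have [uz|uz] := pselect (act u (act g^-1 (act u x)) = act g^-1 (act u x)).
      by rewrite uz actKV.
    have [] := supp _ uz; rewrite actKV => /nu e.
    by case: ux; apply: act_inj e.
  have [nx _] := supp _ uy; rewrite -xE in nx.
  rewrite (nu x nx) -/y.
  have [uuy|uuy] := pselect (act u (act u y) = act u y).
    by case: uy; apply: act_inj uuy.
  by have [/nu -> _] := supp _ uuy.
(* Now [u] commutes with [g]. If [A] moves [x] and [x] is far from [P], then [g x] lies where [u] is
   trivial, so [u] fixes [x] as well. *)
apply: A_faithful => // x; have [/uA //|/moved_by_A [a Aa ax]] := pselect (fixA x).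
have [/nu //|xn] := pselect (near n x).
have gx := nu _ (gP _ _ Aa ax xn).
by apply: (@act_inj g); rewrite -actM Aab // actM.
Qed.

End Core.

Local Close Scope group_scope.

(** * Presented groups *)

Local Open Scope group_scope.

Section GroupHom.
Variables (G H : groupType) (f : {multiplicative G -> H}).

Lemma hom1 : f 1 = 1.
Proof. by apply: (mulgI (f 1)); rewrite -gmulfM !mulg1. Qed.

Lemma homV x : f x^-1 = (f x)^-1.
Proof. by apply: (mulgI (f x)); rewrite -gmulfM !mulgV hom1. Qed.

Lemma homX x n : f (x ^+ n) = f x ^+ n.
Proof. by elim: n => [|n IHn]; rewrite ?hom1 // !expgS gmulfM IHn. Qed.

End GroupHom.

Section Presented.
Variables (X : choiceType) (R : seq (X * bool) -> seq (X * bool) -> Prop).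

Definition generator x : presented R := pres_class R [:: (x, true)].

Lemma pres_class1 : pres_class R [::] = 1.
Proof. by []. Qed.

Lemma generatorV x : (generator x)^-1 = pres_class R [:: (x, false)].
Proof.
apply: (mulgI (generator x)); rewrite mulgV /generator -pres_class_cat -pres_class1.
exact/esym/pres_classP/PresCancel.
Qed.

Lemma pres_rel l r : R l r -> pres_class R l = pres_class R r.
Proof. by move=> lr; apply/pres_classP/PresRel. Qed.

Lemma presented_ind (Q : presented R -> Prop) :
  Q 1 -> (forall x g, Q g -> Q (generator x * g)) ->
  (forall x g, Q g -> Q ((generator x)^-1 * g)) -> forall g, Q g.
Proof.
move=> Q1 QM QV g; rewrite -[g]pres_class_repr.
elim: (repr g) => [|[x b] w IHw] //.
rewrite -[_ :: _]/([:: (x, b)] ++ w) pres_class_cat.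
by case: b; [apply: QM|rewrite -generatorV; apply: QV].
Qed.

Lemma presented_hom_eq (H : groupType) (f g : {multiplicative presented R -> H}) :
  (forall x, f (generator x) = g (generator x)) -> f =1 g.
Proof.
move=> fg; apply: presented_ind => [|x h IH|x h IH]; first by rewrite !hom1.
  by rewrite !gmulfM fg IH.
by rewrite !gmulfM !homV fg IH.
Qed.

Section Lift.
Variables (M : Type) (e : M) (op : Monoid.law e) (l : X * bool -> M).
Hypothesis l_cancel : forall x b, op (l (x, b)) (l (x, ~~ b)) = e.
Hypothesis l_rel : forall v w, R v w -> \big[op/e]_(a <- v) l a = \big[op/e]_(a <- w) l a.

(** Values are taken in a monoid in which only the letters need inverses, so matrices can be used
    without a group of invertible ones. *)
Definition pres_eval (g : presented R) : M := \big[op/e]_(a <- repr g) l a.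

Lemma pres_eval_class w : pres_eval (pres_class R w) = \big[op/e]_(a <- w) l a.
Proof.
suff H v v' : pres_congr R v v' -> \big[op/e]_(a <- v) l a = \big[op/e]_(a <- v') l a.
  exact/H/repr_pres_class.
elim=> //.
- by move=> ? ? ? _ -> _ ->.
- by move=> ? ? ? ? _ e1 _ e2; rewrite !big_cat e1 e2.
- by move=> x b; rewrite !big_cons big_nil Monoid.mulm1.
Qed.

Lemma pres_evalM g h : pres_eval (g * h) = op (pres_eval g) (pres_eval h).
Proof.
by rewrite -{1}[g]pres_class_repr -{1}[h]pres_class_repr -pres_class_cat pres_eval_class big_cat.
Qed.

Lemma pres_eval1 : pres_eval 1 = e.
Proof. by rewrite -pres_class1 pres_eval_class big_nil. Qed.

Lemma pres_eval_generator x : pres_eval (generator x) = l (x, true).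
Proof. by rewrite pres_eval_class big_seq1. Qed.

End Lift.

Lemma presented_hom (H : groupType) (f : X -> H) :
  (forall v w, R v w -> \prod_(a <- v) (if a.2 then f a.1 else (f a.1)^-1) =
    \prod_(a <- w) (if a.2 then f a.1 else (f a.1)^-1)) ->
  exists phi : {multiplicative presented R -> H}, forall x, phi (generator x) = f x.
Proof.
move=> fR; pose l (a : X * bool) := if a.2 then f a.1 else (f a.1)^-1.
have lC x b : l (x, b) * l (x, ~~ b) = 1 by case: b; rewrite /l /= ?mulgV ?mulVg.
pose phi := @pres_eval H 1 *%g l.
have phiM : {morph phi : x y / x * y} by move=> x y; rewrite /phi pres_evalM.
pose mx := isMultiplicative.Build _ _ phi phiM.
pose Phi : {multiplicative presented R -> H} := HB.pack phi mx.
by exists Phi => x; rewrite /= /phi pres_eval_generator.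
Qed.

End Presented.

Local Close Scope group_scope.

(** * The free product of Z^2 and Z *)

Local Open Scope group_scope.

Notation Z2Z := (free_product (groupZ * groupZ)%type groupZ).

Section FreeProduct.

Definition alpha (v : int * int) : Z2Z := generator _ (inl v).
Definition gamma (k : int) : Z2Z := generator _ (inr k).

Lemma alphaD v w : alpha v * alpha w = alpha (v + w)%R.
Proof.
rewrite /alpha /generator -pres_class_cat.
exact: pres_rel (@FreeProductL (groupZ * groupZ)%type groupZ v w).
Qed.

Lemma gammaD k l : gamma k * gamma l = gamma (k + l)%R.
Proof.
rewrite /gamma /generator -pres_class_cat.
exact: pres_rel (@FreeProductR (groupZ * groupZ)%type groupZ k l).
Qed.

Lemma alpha0 : alpha 0%R = 1.
Proof. by apply: (mulgI (alpha 0%R)); rewrite alphaD addr0 mulg1. Qed.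

Lemma gamma0 : gamma 0%R = 1.
Proof. by apply: (mulgI (gamma 0%R)); rewrite gammaD addr0 mulg1. Qed.

Lemma alphaN v : alpha (- v)%R = (alpha v)^-1.
Proof. by apply: (mulgI (alpha v)); rewrite alphaD subrr mulgV alpha0. Qed.

Lemma gammaN k : gamma (- k)%R = (gamma k)^-1.
Proof. by apply: (mulgI (gamma k)); rewrite gammaD subrr mulgV gamma0. Qed.

Lemma alphaX v n : alpha (v *+ n)%R = alpha v ^+ n.
Proof. by elim: n => [|n IHn]; rewrite ?mulr0n ?alpha0 // mulrS -alphaD IHn expgS. Qed.

Lemma gammaX k n : gamma (k *+ n)%R = gamma k ^+ n.
Proof. by elim: n => [|n IHn]; rewrite ?mulr0n ?gamma0 // mulrS -gammaD IHn expgS. Qed.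

Lemma free_product_ind (Q : Z2Z -> Prop) :
  Q 1 -> (forall v g, Q g -> Q (alpha v * g)) -> (forall k g, Q g -> Q (gamma k * g)) ->
  forall g, Q g.
Proof.
move=> Q1 QA QC; apply: presented_ind => // -[v|k] g Qg.
- exact: QA.
- exact: QC.
- by rewrite -/(alpha v) -alphaN; apply: QA.
- by rewrite -/(gamma k) -gammaN; apply: QC.
Qed.

Lemma free_product_hom (H : groupType) (f : int * int -> H) (h : int -> H) :
  (forall v w, f (v + w)%R = f v * f w) -> (forall k l, h (k + l)%R = h k * h l) ->
  exists phi : {multiplicative Z2Z -> H},
    (forall v, phi (alpha v) = f v) /\ (forall k, phi (gamma k) = h k).
Proof.
move=> fD hD; have [|phi phiE] := @presented_hom _ (@free_product_rel (groupZ * groupZ)%type groupZ)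
    H (fun x => match x with inl v => f v | inr k => h k end).
  by move=> _ _ [v w|k l]; rewrite !big_cons !big_nil /= !mulg1 ?fD ?hD.
by exists phi; split=> [v|k]; apply: phiE.
Qed.

Lemma free_product_hom_eq (H : groupType) (f g : {multiplicative Z2Z -> H}) :
  (forall v, f (alpha v) = g (alpha v)) -> (forall k, f (gamma k) = g (gamma k)) -> f =1 g.
Proof. by move=> fgA fgC; apply: presented_hom_eq => -[]. Qed.

(* Every element is [alpha t] times such a product, where [reduced] forbids trivial
   syllables except for a trivial final one. *)
Fixpoint syllables (l : seq (int * (int * int))) : Z2Z :=
  if l is (k, t) :: l' then gamma k * alpha t * syllables l' else 1.

Fixpoint reduced (l : seq (int * (int * int))) : bool :=
  if l is (k, t) :: l' then [&& k != 0%R, (l' == [::]) || (t != 0%R) & reduced l'] else true.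

Lemma normal_form g : exists t l, reduced l /\ g = alpha t * syllables l.
Proof.
elim/free_product_ind: g => [|v g [t [l [lr ->]]]|k g [t [l [lr ->]]]].
- by exists 0%R, [::]; rewrite alpha0 mulg1.
- by exists (v + t)%R, l; rewrite mulgA alphaD.
have [->|k0] := eqVneq k 0%R; first by exists t, l; rewrite gamma0 mul1g.
have [t0|tN0] := eqVneq t 0%R; last first.
  by exists 0%R, ((k, t) :: l); rewrite /= k0 tN0 orbT alpha0 mul1g mulgA.
case: l lr => [_|[k1 t1] l /= /and3P[k10 lt1 lr]].
  by exists 0%R, [:: (k, 0%R)]; rewrite /= k0 t0 alpha0 ?mul1g ?mulg1 ?mul1g.
have -> : gamma k * (alpha t * (gamma k1 * alpha t1 * syllables l)) =
    gamma (k + k1)%R * alpha t1 * syllables l.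
  by rewrite t0 alpha0 mul1g -gammaD !mulgA.
have [->|kk1] := eqVneq (k + k1)%R 0%R; first by exists t1, l; rewrite gamma0 mul1g.
by exists 0%R, ((k + k1, t1)%R :: l); rewrite /= kk1 lt1 alpha0 mul1g.
Qed.

End FreeProduct.

(** * Representing Z^2 * Z by unitriangular 2x2 matrices *)

Section Mat2.
Variable (R : comNzRingType).
Local Open Scope ring_scope.

(* The 2x2 matrix ((p, q), (r, s)). *)
Definition mat2 : Type := (R * R) * (R * R).

Definition mat2_mul (m n : mat2) : mat2 :=
  let: ((p, q), (r, s)) := m in let: ((p', q'), (r', s')) := n in
  ((p * p' + q * r', p * q' + q * s'), (r * p' + s * r', r * q' + s * s')).

Definition mat2_one : mat2 := ((1, 0), (0, 1)).

Lemma mat2_mulA : associative mat2_mul.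
Proof. by move=> [[? ?] [? ?]] [[? ?] [? ?]] [[? ?] [? ?]] /=; congr ((_, _), (_, _)); ring. Qed.

Lemma mat2_mul1 : left_id mat2_one mat2_mul.
Proof. by move=> [[? ?] [? ?]] /=; congr ((_, _), (_, _)); ring. Qed.

Lemma mat2_mulr1 : right_id mat2_one mat2_mul.
Proof. by move=> [[? ?] [? ?]] /=; congr ((_, _), (_, _)); ring. Qed.

HB.instance Definition _ := Monoid.isLaw.Build mat2 mat2_one mat2_mul
  mat2_mulA mat2_mul1 mat2_mulr1.

Definition upper (t : R) : mat2 := ((1, t), (0, 1)).
Definition lower (k : R) : mat2 := ((1, 0), (k, 1)).

Lemma upperD s t : mat2_mul (upper s) (upper t) = upper (s + t).
Proof. by rewrite /upper /=; congr ((_, _), (_, _)); ring. Qed.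

Lemma lowerD s t : mat2_mul (lower s) (lower t) = lower (s + t).
Proof. by rewrite /lower /=; congr ((_, _), (_, _)); ring. Qed.

Lemma lower_upper_mul11 k t (m : mat2) :
  (mat2_mul (mat2_mul (lower k) (upper t)) m).1.1 = m.1.1 + t * m.2.1.
Proof. by case: m => [[? ?] [? ?]] /=; ring. Qed.

Lemma lower_upper_mul21 k t (m : mat2) :
  (mat2_mul (mat2_mul (lower k) (upper t)) m).2.1 = k * (m.1.1 + t * m.2.1) + m.2.1.
Proof. by case: m => [[? ?] [? ?]] /=; ring. Qed.

Lemma upper_mul21 t (m : mat2) : (mat2_mul (upper t) m).2.1 = m.2.1.
Proof. by case: m => [[? ?] [? ?]] /=; ring. Qed.

(** For the matrix unit [E] in the upper right corner, [m (1 + t E) n = 1 + t m E n], and the lower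
    left entry of [m E n] is the product of those of [m] and [n]. *)
Lemma conj_upper21 t (m n : mat2) : mat2_mul m n = mat2_one ->
  (mat2_mul (mat2_mul m (upper t)) n).2.1 = m.2.1 * t * n.2.1.
Proof.
case: m n => [[p q] [r s]] [[p' q'] [r' s']] /= [_ _ rs _].
by rewrite -[RHS]add0r -[in RHS]rs; ring.
Qed.

(** If [m] commutes with its conjugate by [upper t] for a nonzero [t], this makes its lower left
    entry vanish over a domain of characteristic zero. *)
Lemma commutator_upper21 t (m : mat2) :
  (mat2_mul m (mat2_mul (mat2_mul (upper t) m) (upper (- t)))).2.1 -
  (mat2_mul (mat2_mul (mat2_mul (upper t) m) (upper (- t))) m).2.1 = t * m.2.1 ^+ 2 *+ 2.
Proof. by case: m => [[? ?] [? ?]] /=; ring. Qed.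

End Mat2.

Section Representation.
Local Open Scope ring_scope.

Let R := {poly {poly int}}.

(** An additive embedding of Z^2 into a domain. It uses the inner variable, so it does not disturb
    degrees in the outer variable carried by [eta]. *)
Definition theta (v : int * int) : {poly int} := v.1%:P + v.2%:P * 'X.
Definition eta (k : int) : R := k%:P%:P * 'X.

Lemma thetaD v w : theta (v + w) = theta v + theta w.
Proof. by rewrite /theta !raddfD /= mulrDl addrACA. Qed.

Lemma thetaN v : theta (- v) = - theta v.
Proof. by rewrite /theta !raddfN /= mulNr opprD. Qed.

Lemma theta_eq0 v : theta v = 0 -> v = 0.
Proof.
case: v => i j h.
have := congr1 (fun p : {poly int} => p`_0) h; have := congr1 (fun p : {poly int} => p`_1) h.
by rewrite !coefD !coefC !coefMX !coefC /= !add0r addr0 => -> ->.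
Qed.

Lemma etaD k l : eta (k + l) = eta k + eta l.
Proof. by rewrite /eta !raddfD /= mulrDl. Qed.

(* [alpha v] acts by an upper and [gamma k] by a lower unitriangular matrix; the degree in
   the outer variable of the lower left entry counts the syllables of a reduced product. *)
Definition rep_letter (a : (int * int + int) * bool) : mat2 R :=
  match a with
  | (inl v, b) => upper (if b then (theta v)%:P else - (theta v)%:P)
  | (inr k, b) => lower (if b then eta k else - eta k)
  end.

Definition rep (g : Z2Z) : mat2 R := pres_eval (@mat2_mul R) rep_letter g.

Lemma rep_letter_cancel x b :
  mat2_mul (rep_letter (x, b)) (rep_letter (x, ~~ b)) = mat2_one R.
Proof. by case: x b => [v|k] [] /=; rewrite -/(mat2_mul (upper _) (upper _)); congr ((_, _), (_, _)); ring. Qed.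

Lemma rep_letter_rel v w : @free_product_rel (groupZ * groupZ)%type groupZ v w ->
  \big[@mat2_mul R/mat2_one R]_(a <- v) rep_letter a =
  \big[@mat2_mul R/mat2_one R]_(a <- w) rep_letter a.
Proof.
case=> [x y|x y]; rewrite !big_cons !big_nil !Monoid.mulm1 /rep_letter.
  by rewrite upperD -polyCD -thetaD.
by rewrite lowerD -etaD.
Qed.

Lemma repM g h : rep (g * h)%g = mat2_mul (rep g) (rep h).
Proof. exact: (pres_evalM rep_letter_cancel rep_letter_rel). Qed.

Lemma rep1 : rep 1%g = mat2_one R.
Proof. exact: (pres_eval1 rep_letter_cancel rep_letter_rel). Qed.

Lemma rep_alpha v : rep (alpha v) = upper (theta v)%:P.
Proof. exact: (pres_eval_generator rep_letter_cancel rep_letter_rel). Qed.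

Lemma rep_gamma k : rep (gamma k) = lower (eta k).
Proof. exact: (pres_eval_generator rep_letter_cancel rep_letter_rel). Qed.

Lemma alpha_eq1 v : alpha v = 1%g -> v = 0.
Proof.
move=> v1; have := rep_alpha v; rewrite v1 rep1 => -[/esym h].
by apply: theta_eq0; apply: (@polyC_inj {poly int}).
Qed.

Section Rescaled.
Variables (kappa : {multiplicative Z2Z -> Z2Z}) (K : int).
Hypothesis K0 : K != 0.
Hypothesis kappa_alpha : forall v, kappa (alpha v) = alpha (v.1 * K, v.2 * K).
Hypothesis kappa_gamma : forall k, kappa (gamma k) = gamma k.

Let rho g := rep (kappa g).
Let t v : {poly int} := theta (v.1 * K, v.2 * K).

Lemma rhoM g h : rho (g * h)%g = mat2_mul (rho g) (rho h).
Proof. by rewrite /rho gmulfM repM. Qed.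

Lemma rho1 : rho 1%g = mat2_one R.
Proof. by rewrite /rho hom1 rep1. Qed.

Lemma rho_alpha v : rho (alpha v) = upper (t v)%:P.
Proof. by rewrite /rho kappa_alpha rep_alpha. Qed.

Lemma t_eq0 v : (t v == 0) = (v == 0).
Proof.
apply/eqP/eqP => [|->]; last by rewrite /t /= !mul0r /theta /= polyC0 mul0r addr0.
case: v => i j /theta_eq0 [] /eqP; rewrite mulf_eq0 (negPf K0) orbF => /eqP -> /eqP.
by rewrite mulf_eq0 (negPf K0) orbF => /eqP ->.
Qed.

(** Let [u] and [w] be the left column for the tail, with [w] of larger degree. One more syllable
    gives [u + t w], of the degree of [w] since [t] is a nonzero constant in the outer variable, and
    [eta k * (u + t w) + w], of degree one higher. *)
Lemma rho_syllables l : l != [::] -> reduced l ->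
  (size (rho (syllables l)).1.1 < size (rho (syllables l)).2.1)%N.
Proof.
elim: l => // -[k v] l IHl _ /and3P[k0 lv lr].
have kP : k%:P%:P != 0 :> R by rewrite !polyC_eq0.
have -> : rho (syllables ((k, v) :: l)) =
    mat2_mul (mat2_mul (lower (eta k)) (upper (t v)%:P)) (rho (syllables l)).
  by rewrite -rho_alpha -rep_gamma -kappa_gamma -!rhoM.
rewrite lower_upper_mul11 lower_upper_mul21.
have [l0|lN0] := eqVneq l [::].
  rewrite l0 rho1 /mat2_one mulr0 !addr0 size_poly1 mulr1 /eta.
  by rewrite size_mulX // size_polyC polyC_eq0 k0.
rewrite (negPf lN0) in lv; have {IHl} := IHl lN0 lr.
move: (rho (syllables l)).1.1 (rho (syllables l)).2.1 => u w lt_uw.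
have tv0 : t v != 0 by rewrite t_eq0.
have szt : size ((t v)%:P * w) = size w by rewrite size_Cmul.
have szu : size (u + (t v)%:P * w) = size w by rewrite addrC size_polyDl szt.
have u0 : u + (t v)%:P * w != 0 by rewrite -size_poly_eq0 szu -lt0n (leq_trans _ lt_uw).
have sze : size (eta k * (u + (t v)%:P * w)) = (size w).+1.
  by rewrite /eta mulrAC size_mulX ?mulf_neq0 // size_Cmul ?polyC_eq0 // szu.
by rewrite szu size_polyDl sze.
Qed.

(** The leading [alpha] does not affect the lower left entry, and by degree any remaining syllable
    makes it nonzero. *)
Lemma rho_lower_eq0 g : (rho g).2.1 = 0 -> exists v, g = alpha v.
Proof.
have [v [l [lr ->]]] := normal_form g; case: (eqVneq l [::]) => [->|lN0].
  by exists v; rewrite mulg1.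
rewrite rhoM rho_alpha upper_mul21 => e.
by have := rho_syllables lN0 lr; rewrite e size_poly0.
Qed.

Lemma rho_alphaN v : rho (alpha v)^-1%g = upper (- (t v)%:P).
Proof. by rewrite -alphaN rho_alpha /t /= !mulNr (thetaN (_, _)) polyCN. Qed.

Lemma rho_alpha_malnormal u v w : v <> 0 -> (u * alpha v * u^-1)%g = alpha w ->
  exists w', u = alpha w'.
Proof.
move=> v0 /(congr1 rho); rewrite !rhoM !rho_alpha => e.
have uV : mat2_mul (rho u) (rho u^-1%g) = mat2_one R by rewrite -rhoM mulgV rho1.
have : (rho u).2.1 * (t v)%:P * (rho u^-1%g).2.1 == 0 by rewrite -conj_upper21 // e.
rewrite !mulf_eq0 polyC_eq0 t_eq0 -orbA => /or3P[/eqP r0|/eqP //|/eqP r0].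
  exact: rho_lower_eq0.
have [w' uE] := rho_lower_eq0 r0.
by exists (- w'); rewrite alphaN -uE invgK.
Qed.

Lemma rho_conj_commute u v : v <> 0 ->
  kappa (u * (alpha v * u * (alpha v)^-1))%g = kappa (alpha v * u * (alpha v)^-1 * u)%g ->
  exists w, u = alpha w.
Proof.
move=> v0 /(congr1 rep); rewrite -!/(rho _) !rhoM rho_alpha rho_alphaN => e.
have := commutator_upper21 (t v)%:P (rho u); rewrite e subrr => /esym/eqP.
rewrite -mulr_natr -2!polyC_natr !mulf_eq0 !polyC_eq0 t_eq0 orbF orbb.
case/orP=> /eqP // ; exact: rho_lower_eq0.
Qed.

End Rescaled.
End Representation.

Local Close Scope group_scope.

Local Open Scope group_scope.

Lemma finite_invariant_periodic (f : cantor_space -> cantor_space) (S : seq cantor_space) p :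
  injective f -> {in S, forall q, f q \in S} -> p \in S -> exists2 l, 0 < l & iter l f p = p.
Proof.
move=> f_inj fS pS.
have [q _ qP] : exists2 q, q \in S & forall J, exists2 j, J <= j & iter j f p = q.
  apply: pigeonhole => J; exists J, (iter J f p); split=> //.
  by elim: J => //= J; apply: fS.
have [i _ qi] := qP 0; have [j ij qj] := qP i.+1.
exists (j - i); first by rewrite subn_gt0.
by apply: iter_sub; rewrite ?qi // ltnW.
Qed.

Lemma pair_addE (i j k l : int) : ((i, j) + (k, l) = (i + k, j + l))%R.
Proof. by []. Qed.

Lemma pair_oppE (i j : int) : (- (i, j) = (- i, - j))%R.
Proof. by []. Qed.

(** * Z^2 * Z does not embed into V *)

Section NoEmbedding.
Variable phi : {multiplicative Z2Z -> thompson_V}.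
Hypothesis phi_inj : injective phi.
Implicit Types (x y p : cantor_space) (v w : int * int).

Let a := phi (alpha (1, 0)%R).
Let b := phi (alpha (0, 1)%R).

Lemma ab_commute : a * b = b * a.
Proof. by rewrite -!gmulfM !alphaD. Qed.

Let periodic (f : thompson_V) y := exists2 l, 0 < l & iter l (val f) y = y.

Variables (Sa Sb : seq cantor_space) (ka kb : nat).
Hypotheses (ka0 : 0 < ka) (kb0 : 0 < kb).
Hypothesis SaP : forall p, p \in Sa <-> important (val a) p.
Hypothesis SbP : forall p, p \in Sb <-> important (val b) p.
Hypothesis kaP : forall y, periodic a y ->
  iter ka (val a) y = y /\ (y \in Sa \/ locally_trivial (iter ka (val a)) y).
Hypothesis kbP : forall y, periodic b y ->
  iter kb (val b) y = y /\ (y \in Sb \/ locally_trivial (iter kb (val b)) y).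
Hypothesis Sa_attracts : forall n, exists T0, forall T y, T0 <= T -> [\/ periodic a y,
  exists2 p, p \in Sa & agree n p y | exists2 p, p \in Sa & agree n p (iter T (val a) y)].
Hypothesis Sb_attracts : forall n, exists T0, forall T y, T0 <= T -> [\/ periodic b y,
  exists2 p, p \in Sb & agree n p y | exists2 p, p \in Sb & agree n p (iter T (val b) y)].

Let K : nat := ka * kb.
Let P := Sa ++ Sb.

Lemma K_gt0 : 0 < K. Proof. by rewrite muln_gt0 ka0. Qed.

Lemma V_uniform (f : thompson_V) n :
  exists m, forall x y, agree m x y -> agree n (val f x) (val f y).
Proof. by have [L fL] := V_cone f; exists (L + n) => x y; apply: agree_f. Qed.

(** Since [b] commutes with [a], it permutes the finitely many important points of [a]. *)
Lemma Sa_b_periodic p : p \in Sa -> periodic b p.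
Proof.
move=> pS; apply: finite_invariant_periodic pS; first exact: val_V_inj.
move=> q /SaP qa; apply/SaP; apply: important_commute qa.
- exact: val_V_inj.
- by move=> x; rewrite -!val_VM ab_commute.
- exact: V_uniform.
Qed.

Lemma Sb_a_periodic p : p \in Sb -> periodic a p.
Proof.
move=> pS; apply: finite_invariant_periodic pS; first exact: val_V_inj.
move=> q /SbP qb; apply/SbP; apply: important_commute qb.
- exact: val_V_inj.
- by move=> x; rewrite -!val_VM ab_commute.
- exact: V_uniform.
Qed.

Lemma periodic_a_fix p M : periodic a p -> val (a ^+ (K * M)) p = p.
Proof. by move=> /kaP[e _]; rewrite val_VX -mulnA iter_mul_fix. Qed.

Lemma periodic_b_fix p M : periodic b p -> val (b ^+ (K * M)) p = p.
Proof. by move=> /kbP[e _]; rewrite val_VX [K]mulnC -mulnA iter_mul_fix. Qed.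

Lemma P_periodic p : p \in P -> periodic a p /\ periodic b p.
Proof.
rewrite mem_cat => /orP[pS|pS].
  by split; [have /SaP[] := pS|apply: Sa_b_periodic].
by split; [apply: Sb_a_periodic|have /SbP[] := pS].
Qed.

(* [K] is a common period: after rescaling, [Z^2] fixes every important point of [a] and
   [b]. *)
Variable kappa : {multiplicative Z2Z -> Z2Z}.
Hypothesis kappa_alpha : forall v, kappa (alpha v) = alpha (v.1 * K, v.2 * K)%R.
Hypothesis kappa_gamma : forall k, kappa (gamma k) = gamma k.

Let psi g := phi (kappa g).

Lemma psiM g h : psi (g * h) = psi g * psi h.
Proof. by rewrite /psi !gmulfM. Qed.

Lemma psi1 : psi 1 = 1.
Proof. by rewrite /psi !hom1. Qed.

Lemma psiV g : psi g^-1 = (psi g)^-1.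
Proof. by rewrite /psi !homV. Qed.

Lemma psi_a (M : nat) : psi (alpha (M%:Z, 0)%R) = a ^+ (K * M).
Proof.
rewrite /psi kappa_alpha /a -homX -alphaX; congr (phi (alpha _)).
by rewrite pairMnE /= mul0r mul0rn -PoszM mulnC natz.
Qed.

Lemma psi_b (M : nat) : psi (alpha (0, M%:Z)%R) = b ^+ (K * M).
Proof.
rewrite /psi kappa_alpha /b -homX -alphaX; congr (phi (alpha _)).
by rewrite pairMnE /= mul0r mul0rn -PoszM mulnC natz.
Qed.

Lemma psi_alpha_ind (Q : thompson_V -> Prop) :
  Q 1 -> (forall f g, Q f -> Q g -> Q (f * g)) -> (forall f, Q f -> Q f^-1) ->
  Q (a ^+ K) -> Q (b ^+ K) -> forall v, Q (psi (alpha v)).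
Proof.
move=> Q1 QM QV Qa Qb [i j].
have QX f n : Q f -> Q (f ^+ n) by move=> Qf; elim: n => // n IHn; rewrite expgS; apply: QM.
have -> : (i, j) = ((i, 0) + (0, j))%R by rewrite pair_addE addr0 add0r.
rewrite -alphaD psiM; apply: QM.
  case: (intP i) => [|n|n]; last 1 first.
  - have -> : ((- n.+1%:Z, 0) = - (n.+1%:Z, 0 : int))%R by rewrite pair_oppE oppr0.
    by rewrite alphaN psiV psi_a expgnA; apply/QV/QX.
  - by rewrite alpha0 psi1.
  - by rewrite psi_a expgnA; apply: QX.
case: (intP j) => [|n|n]; last 1 first.
- have -> : ((0, - n.+1%:Z) = - (0 : int, n.+1%:Z))%R by rewrite pair_oppE oppr0.
  by rewrite alphaN psiV psi_b expgnA; apply/QV/QX.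
- by rewrite alpha0 psi1.
- by rewrite psi_b expgnA; apply: QX.
Qed.

Lemma psi_alpha_fix p v : periodic a p -> periodic b p -> val (psi (alpha v)) p = p.
Proof.
move=> pa pb; apply: (@psi_alpha_ind (fun f => val f p = p)) => //.
- by move=> f g fp gp; rewrite val_VM gp.
- by move=> f {1}<-; rewrite val_VK.
- by have := periodic_a_fix 1 pa; rewrite muln1.
- by have := periodic_b_fix 1 pb; rewrite muln1.
Qed.

Lemma psi_alpha_trivial p v : locally_trivial (val (a ^+ K)) p ->
  locally_trivial (val (b ^+ K)) p -> locally_trivial (val (psi (alpha v))) p.
Proof.
move=> ta tb; apply: (@psi_alpha_ind (fun f => locally_trivial (val f) p)) => //; first by exists 0.
  move=> f g [m fp] [n gp]; exists (maxn m n) => y py.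
  rewrite val_VM gp ?fp //; apply: agree_le py; [exact: leq_maxl|exact: leq_maxr].
by move=> f [n fp]; exists n => y /fp {1}<-; rewrite val_VK.
Qed.

(** The two germs are measured by the integers [e2 - e1] and [d2 - d1], and the vector
    [(d2 - d1, e1 - e2)] solves the linear relation between them. It could vanish if [e1 = e2], but
    then the first basis vector has a trivial germ. *)
Lemma psi_germ_kernel p : p \in P ->
  exists2 v, v <> 0%R & locally_trivial (val (psi (alpha v))) p.
Proof.
move=> /P_periodic[pa pb].
have [e1 [e2 ga]] := germ_exists (psi_alpha_fix (1, 0)%R pa pb).
have [d1 [d2 gb]] := germ_exists (psi_alpha_fix (0, 1)%R pa pb).
have [ee|ee] := eqVneq e1 e2.
  by exists (1, 0)%R => //; rewrite ee in ga; apply: germ_trivial ga.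
pose f := psi (alpha (1, 0)%R); pose g := psi (alpha (0, 1)%R).
exists (d2%:Z - d1%:Z, e1%:Z - e2%:Z)%R.
  by case=> _ /eqP; rewrite subr_eq0 eqz_nat (negPf ee).
have -> : psi (alpha (d2%:Z - d1%:Z, e1%:Z - e2%:Z)%R) =
    f ^+ d2 * (f ^+ d1)^-1 * g ^+ e1 * (g ^+ e2)^-1.
  rewrite /f /g /psi -!homX -!homV -!gmulfM; congr (phi (kappa _)).
  rewrite -!alphaX -!alphaN !alphaD; congr alpha.
  by rewrite !pairMnE /= !mul0rn !pair_oppE !pair_addE !oppr0 !addr0 !add0r !natz.
apply: (@germ_trivial _ _ (d2 * e1 + d1 * e2 + e1 * d1 + e2 * d2)%N).
suff {2}-> : (d2 * e1 + d1 * e2 + e1 * d1 + e2 * d2 = d2 * e2 + d1 * e1 + e1 * d2 + e2 * d1)%N.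
  exact: germM (germM (germM (germX _ ga) (germV (germX _ ga))) (germX _ gb)) (germV (germX _ gb)).
lia.
Qed.

(** If [x] is not periodic for [a], the power of [a] brings it close to a point of [Sa], which [g]
    fixes, so by continuity [g] keeps it close. If [x] is periodic for [a], the power of [a] fixes
    it, and [g] does the work because [x] cannot be periodic for [b] too. *)
Lemma psi_contract n : exists2 v, v <> 0%R & forall x w, val (psi (alpha w)) x <> x ->
  ~ (exists2 p, p \in P & agree n p x) ->
  exists2 p, p \in P & agree n p (val (psi (alpha v)) x).
Proof.
have K0 := K_gt0.
have [Tb TbP] := Sb_attracts n; pose g := b ^+ (K * Tb.+1).
have gfix p : p \in P -> val g p = p.
  by move=> /P_periodic[_ pb]; apply: periodic_b_fix.
have [m mP] := V_uniform g n.
have [Ta TaP] := Sa_attracts (maxn n m).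
(* The successors make the vector nonzero; the exponents still exceed the attraction times because
   [K] is positive. *)
exists (Ta.+1%:Z, Tb.+1%:Z)%R => // x w xw xfar.
have -> : psi (alpha (Ta.+1%:Z, Tb.+1%:Z)%R) = g * a ^+ (K * Ta.+1).
  by rewrite /g -psi_a -psi_b -psiM alphaD pair_addE add0r addr0.
rewrite val_VM.
have leK T : (T <= K * T.+1)%N by rewrite (leq_trans (leqnSn T)) // leq_pmull.
have [xa|nxa] := pselect (periodic a x); last first.
  have [//|[p pS px]|[p pS px]] := TaP _ x (leK Ta).
    case: xfar; exists p; first by rewrite mem_cat pS.
    by apply: agree_le px; apply: leq_maxl.
  have pP : p \in P by rewrite mem_cat pS.
  exists p => //; rewrite -(gfix p pP) val_VX; apply: mP.
  by apply: agree_le px; apply: leq_maxr.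
rewrite periodic_a_fix //.
have [xb|[p pS px]|[p pS px]] := TbP _ x (leK Tb).
- by case: xw; apply: psi_alpha_fix.
- by case: xfar; exists p => //; rewrite mem_cat pS orbT.
- by exists p; [rewrite mem_cat pS orbT|rewrite val_VX].
Qed.

(** Such an [x] is periodic for [a] and [b] and important for neither, so suitable powers of both
    are trivial near it. *)
Lemma psi_neutral x v : x \notin P -> (forall w, val (psi (alpha w)) x = x) ->
  locally_trivial (val (psi (alpha v))) x.
Proof.
have K0 := K_gt0; rewrite mem_cat negb_or => /andP[xa xb] fix_x.
have iter_trivial (f : cantor_space -> cantor_space) l M :
    locally_trivial (iter l f) x -> locally_trivial (iter (l * M) f) x.
  by move=> [n triv]; exists n => y /triv; apply: iter_mul_fix.
have lt_X (f : thompson_V) l M : locally_trivial (iter l (val f)) x ->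
    locally_trivial (val (f ^+ (l * M))) x.
  by move=> [n triv]; exists n => y /triv; rewrite val_VX; apply: iter_mul_fix.
apply: psi_alpha_trivial.
  have [|_ [|]] := @kaP x; [|by rewrite (negPf xa)|exact: lt_X].
  by exists K => //; rewrite -val_VX -[K]muln1 -psi_a fix_x.
have [|_ [|]] := @kbP x; [|by rewrite (negPf xb)|by rewrite /K mulnC; apply: lt_X].
by exists K => //; rewrite -val_VX -[K]muln1 -psi_b fix_x.
Qed.

Lemma no_embedding_aux : False.
Proof.
have K0 : (K%:Z != 0)%R by rewrite eqz_nat -lt0n K_gt0.
have alphaN1 v : alpha v <> 1 -> v <> 0%R by move=> h v0; apply: h; rewrite v0 alpha0.
have N1alpha v : v <> 0%R -> alpha v <> 1 by move=> h /alpha_eq1.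
apply: (@no_action Z2Z (fun g => val (psi g)) (fun g => exists v, g = alpha v) P
  (alpha (1, 0)%R) (gamma 1)).
- by move=> x; rewrite psi1.
- by move=> g h x; rewrite psiM val_VM.
- by move=> g n; apply: V_uniform.
- by move=> _ _ [v ->] [w ->]; exists (v + w)%R; rewrite alphaD.
- by move=> _ [v ->]; exists (- v)%R; rewrite alphaN.
- by move=> _ _ [v ->] [w ->]; rewrite !alphaD addrC.
- move=> u _ [v ->] /alphaN1 v0 [w]; exact: (rho_alpha_malnormal K0 kappa_alpha kappa_gamma).
- move=> u _ [v ->] /alphaN1 v0 e.
  apply: (rho_conj_commute K0 kappa_alpha kappa_gamma v0).
  by apply/phi_inj/V_ext.
- move=> _ [v ->] e; have /phi_inj : phi (kappa (alpha v)) = phi 1.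
    by rewrite hom1; apply: V_ext.
  rewrite kappa_alpha => /alpha_eq1 v0.
  have /eqP : (v.1 * K%:Z = 0)%R := congr1 fst v0.
  have /eqP : (v.2 * K%:Z = 0)%R := congr1 snd v0.
  rewrite !mulf_eq0 (negPf K0) !orbF => /eqP v2 /eqP v1.
  by rewrite [v]surjective_pairing v1 v2 alpha0.
- move=> [v e]; have := congr1 rep e; rewrite rep_gamma rep_alpha => -[_ /eqP].
  by rewrite /eta mulf_eq0 polyX_eq0 orbF !polyC_eq0.
- by exists (1, 0)%R.
- exact: N1alpha.
- by move=> _ p [v ->] /P_periodic[]; apply: psi_alpha_fix.
- by move=> p /psi_germ_kernel[v v0 h]; exists (alpha v); split=> //; [exists v|apply: N1alpha].
- by move=> p g h _ gp hp; rewrite !psiM !psiV; apply: germ_commutator.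
- move=> x _ xP fix_x [v ->]; apply: psi_neutral => // w.
  by apply: fix_x; exists w.
- move=> n; have [v v0 vP] := psi_contract n; exists (alpha v).
  by split; [exists v|apply: N1alpha|move=> x _ [w ->]; apply: vP].
Qed.

End NoEmbedding.

Theorem Z2Z_not_in_V : ~ embeds Z2Z thompson_V.
Proof.
move=> [phi phi_inj].
have dyn (f : thompson_V) : exists (S : seq cantor_space) k, [/\ 0 < k,
    forall p, p \in S <-> important (val f) p,
    forall y, (exists2 l, 0 < l & iter l (val f) y = y) ->
      iter k (val f) y = y /\ (y \in S \/ locally_trivial (iter k (val f)) y) &
    forall n, exists T0, forall T y, T0 <= T -> [\/ exists2 l, 0 < l & iter l (val f) y = y,
      exists2 p, p \in S & agree n p y | exists2 p, p \in S & agree n p (iter T (val f) y)]].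
  by have [L fL] := V_cone f; apply: dynamics fL; apply: val_V_inj.
have [Sa [ka [ka0 SaP kaP Sa_attracts]]] := dyn (phi (alpha (1, 0)%R)).
have [Sb [kb [kb0 SbP kbP Sb_attracts]]] := dyn (phi (alpha (0, 1)%R)).
have [||kappa [kA kC]] := @free_product_hom Z2Z
  (fun v => alpha (v.1 * (ka * kb)%N%:Z, v.2 * (ka * kb)%N%:Z)%R) gamma.
- by move=> v w; rewrite alphaD /= !mulrDl.
- by move=> k l; rewrite gammaD.
exact: (no_embedding_aux phi_inj ka0 kb0 SaP SbP kaP kbP Sa_attracts Sb_attracts kA kC).
Qed.

Local Close Scope group_scope.

(** * Graph groups *)

Local Open Scope group_scope.

Lemma embeds_trans (G H K : groupType) : embeds G H -> embeds H K -> embeds G K.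
Proof. by move=> [f fI] [g gI]; exists (g \o f : {multiplicative _ -> _}); apply: inj_comp. Qed.

Lemma isomorphic_sym (G H : groupType) : isomorphic G H -> isomorphic H G.
Proof.
move=> [f [g fK gK]].
pose gM := isMultiplicative.Build _ _ g (can2_gmulfM fK gK).
pose g' : {multiplicative H -> G} := HB.pack g gM.
by exists g', f.
Qed.

Lemma isomorphic_embeds (G H : groupType) : isomorphic G H -> embeds G H.
Proof. by move=> [f /bij_inj fI]; exists f. Qed.

Section Image.
Variables (G H : groupType) (f : {multiplicative G -> H}).

Definition hom_image : {pred H} := fun y => `[< exists x, f x = y >].

Fact hom_image1 : 1 \in hom_image.
Proof. by apply/asboolP; exists 1; rewrite hom1. Qed.
Fact hom_imageM : {in hom_image &, forall x y, x * y \in hom_image}.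
Proof.
move=> _ _ /asboolP[x <-] /asboolP[y <-]; apply/asboolP.
by exists (x * y); rewrite gmulfM.
Qed.
Fact hom_imageV : {in hom_image, forall x, x^-1 \in hom_image}.
Proof. by move=> _ /asboolP[x <-]; apply/asboolP; exists x^-1; rewrite homV. Qed.

Definition image_group : groupClosed H := HB.pack hom_image
  (isMulClosed.Build H hom_image hom_imageM) (isMul1Closed.Build H hom_image hom_image1)
  (isInvClosed.Build H hom_image hom_imageV).

End Image.

Lemma embeds_subgroup (G K : groupType) : embeds K G <-> has_subgroup_isomorphic_to G K.
Proof.
split=> [[f f_inj]|[S /isomorphic_sym [f /bij_inj f_inj]]]; last first.
  pose g (x : K) : G := subgroup_val (f x).
  have gM : {morph g : x y / x * y} by move=> x y; rewrite /g gmulfM.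
  pose mg := isMultiplicative.Build _ _ g gM.
  pose g' : {multiplicative K -> G} := HB.pack g mg.
  by exists g' => x y /= /val_inj /f_inj.
exists (image_group f); apply: isomorphic_sym.
have fP x : f x \in image_group f by apply/asboolP; exists x.
pose g (x : K) : subgroup (image_group f) := Subgroup (fP x).
have gM : {morph g : x y / x * y} by move=> x y; apply: val_inj; rewrite /= gmulfM.
pose mg := isMultiplicative.Build _ _ g gM.
pose g' : {multiplicative K -> subgroup (image_group f)} := HB.pack g mg.
have /choice[h hP] (y : subgroup (image_group f)) : exists x, f x = subgroup_val y.
  by have /asboolP := subgroupP y.
exists g', h => [x|y]; first by apply: f_inj; rewrite hP.
by apply: val_inj; apply: hP.
Qed.

Section IntegerPowers.
Variable G : groupType.
Implicit Types x y : G.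

Definition expgz x (n : int) : G := match n with Posz n => x ^+ n | Negz n => x ^- n.+1 end.

Lemma expgzS x n : expgz x (1 + n)%R = x * expgz x n.
Proof.
case: n => [n|[|n]].
- by rewrite -[(1 + n%:Z)%R]/(Posz n.+1) /= expgS.
- by rewrite -[(1 + Negz 0)%R]/(Posz 0) /= mulgV.
have -> : (1 + Negz n.+1 = Negz n)%R by lia.
by rewrite /= [x ^+ n.+2]expgSr invgM mulVKg.
Qed.

Lemma expgzD x m n : expgz x (m + n)%R = expgz x m * expgz x n.
Proof.
elim: m => [|m IHm|m IHm]; first by rewrite add0r mul1g.
  by rewrite -add1n PoszD -addrA !expgzS IHm mulgA.
apply: (mulgI x); rewrite mulgA -!expgzS addrA.
have -> : (1 + - m.+1%:Z = - m%:Z)%R by lia.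
exact: IHm.
Qed.

Lemma commute_expgz x y m n : commute x y -> commute (expgz x m) (expgz y n).
Proof.
have H a b k : commute a b -> commute a (expgz b k).
  move=> ab; case: k => k /=; first exact: commuteX.
  exact/commuteV/commuteX.
by move=> xy; apply/H/commute_sym/H/commute_sym.
Qed.

End IntegerPowers.

Lemma pair_mulz (i j : int) : ((1 : int, 0 : int) *~ i + (0 : int, 1 : int) *~ j)%R = (i, j).
Proof.
have mulz0 n k : ((0 : int, k : int) *~ n = (0, k * n))%R.
  case: n => n; rewrite ?NegzE ?mulrNz -pmulrn pairMnE mul0rn -mulr_natr natz //.
  by rewrite mulrN; congr (_, _); rewrite oppr0.
have mulz1 n k : ((k : int, 0 : int) *~ n = (k * n, 0))%R.
  case: n => n; rewrite ?NegzE ?mulrNz -pmulrn pairMnE mul0rn -mulr_natr natz //.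
  by rewrite mulrN; congr (_, _); rewrite oppr0.
by rewrite mulz0 mulz1 !mul1r; congr (_, _); rewrite /= ?addr0 ?add0r.
Qed.

Lemma hom_expgz (G H : groupType) (f : {multiplicative G -> H}) x n :
  f (expgz x n) = expgz (f x) n.
Proof. by case: n => n; rewrite /= ?homV homX. Qed.

Lemma alpha_expgz v n : expgz (alpha v) n = alpha (v *~ n)%R.
Proof. by case: n => n /=; rewrite -alphaX // -alphaN. Qed.

Lemma gamma_expgz k n : expgz (gamma k) n = gamma (k *~ n)%R.
Proof. by case: n => n /=; rewrite -gammaX // -gammaN. Qed.

Section GraphGroup.
Variable Gamma : sgraph.
Implicit Types u v w : Gamma.

Definition vgen u : graph_group Gamma := generator _ u.

Lemma vgen_commute u v : edge u v -> commute (vgen u) (vgen v).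
Proof.
move=> uv; rewrite /commute /vgen /generator -!pres_class_cat.
exact/pres_rel/GraphGroupComm.
Qed.

Lemma graph_group_hom (H : groupType) (f : Gamma -> H) :
  (forall u v, edge u v -> commute (f u) (f v)) ->
  exists phi : {multiplicative graph_group Gamma -> H}, forall u, phi (vgen u) = f u.
Proof.
move=> fE; apply: (@presented_hom _ (@graph_group_rel Gamma) H f).
by move=> _ _ [u v uv]; rewrite !big_cons !big_nil /= !mulg1 fE.
Qed.

Definition nonedge_transitive := forall u v w, edge u v -> edge u w || edge v w.

Lemma Z2Z_in_graph_group : ~ nonedge_transitive -> embeds Z2Z (graph_group Gamma).
Proof.
move=> /existsNP[u /existsNP[v /existsNP[w /not_implyP[uv /negP]]]].
rewrite negb_or => /andP[nuw nvw].
have uNv : u != v by apply/eqP => e; rewrite e edge_irrefl in uv.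
have wNu : w != u by apply/eqP => e; rewrite e edge_sym uv in nvw.
have wNv : w != v by apply/eqP => e; rewrite e uv in nuw.
have [||theta [thA thC]] := @free_product_hom (graph_group Gamma)
    (fun z => expgz (vgen u) z.1 * expgz (vgen v) z.2) (expgz (vgen w)).
- move=> [i j] [k l] /=; rewrite !expgzD !mulgA; congr (_ * _).
  by rewrite -!mulgA; congr (_ * _); apply/commute_expgz/vgen_commute.
- exact: expgzD.
(* A left inverse of [theta], killing all other vertices. It respects every edge because [u], [v] is
   the only adjacent pair among the three vertices. *)
pose img t := if t == u then alpha (1, 0)%R else if t == v then alpha (0, 1)%R
  else if t == w then gamma 1%R else 1.
have [s t st|lam lamE] := @graph_group_hom _ img.
  rewrite /img.
  have nuu := edge_irrefl u; have nvv := edge_irrefl v; have nww := edge_irrefl w.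
  have c1 (g : Z2Z) : commute g 1 by apply: commute1.
  have c1' (g : Z2Z) : commute 1 g by apply/commute_sym/commute1.
  have cA a b : commute (alpha a) (alpha b) by rewrite /commute !alphaD addrC.
  case: (eqVneq s u) st => [->|_]; [|case: (eqVneq s v) => [->|_]; [|case: (eqVneq s w) => [->|_]]];
  (case: (eqVneq t u) => [->|_]; [|case: (eqVneq t v) => [->|_]; [|case: (eqVneq t w) => [->|_]]]) => //.
  - by rewrite (negPf nuw).
  - by rewrite (negPf nvw).
  - by rewrite edge_sym (negPf nuw).
  - by rewrite edge_sym (negPf nvw).
exists theta; apply: (can_inj (g := lam)) => g.
have e : (lam \o theta : {multiplicative _ -> _}) =1 (idfun : {multiplicative _ -> _}).
  apply: free_product_hom_eq => [[i j]|k] /=.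
    rewrite thA gmulfM !hom_expgz !lamE /img eqxx eq_sym (negPf uNv) eqxx.
    rewrite !alpha_expgz alphaD; congr alpha.
    exact: pair_mulz.
  rewrite thC hom_expgz lamE /img (negPf wNu) (negPf wNv) eqxx gamma_expgz.
  by rewrite intz.
exact: e.
Qed.

End GraphGroup.

Local Close Scope group_scope.

(** * Commuting partitions and non-adjacency classes *)

Section Eccentricity.
Variable Gamma : sgraph.
Implicit Types u v w : Gamma.

Lemma walk0 u v : walk 0 u v = (u == v).
Proof.
apply/existsP/idP => [[p]|uv]; first by rewrite (tuple0 p).
by exists [tuple].
Qed.

Lemma walk1 u v : walk 1 u v = edge u v.
Proof.
apply/existsP/idP => [[p]|uv]; last by exists [tuple v]; rewrite /= uv eqxx.
by case/tupleP: p => t p; rewrite (tuple0 p) /= andbT => /andP[ut /eqP <-].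
Qed.

Lemma distance_edge u v : edge u v -> distance u v = 1%E.
Proof.
move=> uv; rewrite /distance; case: pselect => [ex|[]]; last by exists 1; rewrite walk1.
congr (_%:E)%E; case: ex_minnP => n wn n_min.
have : (n <= 1)%N by apply: n_min; rewrite walk1.
case: n wn {n_min} => [|[|n]] //; rewrite walk0 => /eqP e.
by rewrite e edge_irrefl in uv.
Qed.

Lemma distance_le1 u v : v != u -> (distance u v <= 1)%E -> edge u v.
Proof.
move=> vu; rewrite /distance; case: pselect => // ex.
case: ex_minnP => n wn _; rewrite lee_fin.
case: n wn => [|[|n]] //; first by rewrite walk0 eq_sym (negPf vu).
by rewrite walk1.
Qed.

Lemma eccentricity1 v : (eccentricity v == 1%E) <->
  (exists u, u != v) /\ forall u, u != v -> edge v u.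
Proof.
split=> [/eqP e|[[u uv] vE]].
  split=> [|u uv]; last first.
    by apply: distance_le1 => //; rewrite -e; apply: le_bigmax_cond.
  apply: contrapT => /forallNP h; move: e.
  by rewrite /eccentricity big_pred0 // => u; apply/negbTE/negP/h.
apply/eqP/le_anti/andP; split.
  by apply: bigmax_le => // w wv; rewrite distance_edge // vE.
by rewrite -(distance_edge (vE u uv)); apply: le_bigmax_cond.
Qed.

(** If [w] shares its part with both [u] and [v], that part contains an edge, so it is the part of
    index 0, whose vertices are adjacent to all others. *)
Lemma GP_nonedge_transitive : GP Gamma -> nonedge_transitive Gamma.
Proof.
move=> [n [P [[cov _ _] P0 Pin Pout]]] u v w uv.
have part x : exists i, x \in P i.
  by have : x \in \bigcup_i P i; [rewrite cov inE|case/bigcupP => i _; exists i].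
have [i ui] := part u; have [j vj] := part v; have [k wk] := part w.
have [ik|/Pout h] := eqVneq i k; last by rewrite (h _ _ ui wk).
have [jk|/Pout h] := eqVneq j k; last by rewrite (h _ _ vj wk) orbT.
subst i j; have [k0|kN0] := eqVneq k ord0; last first.
  by have := Pin _ _ _ kN0 ui vj; rewrite uv.
move: ui; rewrite k0 P0 inE => /eccentricity1[_ uE].
have [->|wu] := eqVneq w u; last by rewrite uE.
by rewrite edge_sym edge_sym (edge_sym v) uv orbT.
Qed.

(** [pick] depends only on the predicate, so vertices with the same non-neighbours get the same
    representative. The default never occurs, since [v] is not adjacent to itself. *)
Definition class_rep v : Gamma := odflt v [pick u | ~~ edge v u].

Hypothesis NT : nonedge_transitive Gamma.

Lemma class_rep_nonedge v : ~~ edge v (class_rep v).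
Proof. by rewrite /class_rep; case: pickP => //= _; rewrite edge_irrefl. Qed.

Lemma class_repP u v : (class_rep u == class_rep v) = ~~ edge u v.
Proof.
apply/eqP/idP => [e|nuv].
  apply/negP => uv; have := NT (class_rep u) uv.
  by rewrite {2}e (negPf (class_rep_nonedge u)) (negPf (class_rep_nonedge v)).
have uvE : (fun w => ~~ edge u w) =1 (fun w => ~~ edge v w).
  move=> w; congr negb; apply/idP/idP => [uw|vw].
    by have := NT v uw; rewrite (negPf nuv) edge_sym.
  by have := NT u vw; rewrite edge_sym (negPf nuv) edge_sym.
rewrite /class_rep (eq_pick uvE); case: pickP => // /(_ v).
by rewrite edge_irrefl.
Qed.

Lemma class_repK v : class_rep (class_rep v) = class_rep v.
Proof. by apply/eqP; rewrite class_repP edge_sym class_rep_nonedge. Qed.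

Lemma nonedge_transitive_GP : GP Gamma.
Proof.
(* A vertex of eccentricity one is a class by itself. The only other singleton class is that of the
   one-vertex graph: its vertex has eccentricity 0 and forms the part of index 1. *)
pose D := [set v | (eccentricity v != 1%E) && (class_rep v == v)].
have DP v : (v \in D) = (eccentricity v != 1%E) && (class_rep v == v) by rewrite inE.
have valD (j : 'I_#|D|) : enum_val j \in D by apply: enum_valP.
pose P (i : 'I_#|D|.+1) : {set Gamma} :=
  if unlift ord0 i is Some j then [set v | class_rep v == enum_val j]
  else [set v | eccentricity v == 1%E].
have P0 : P ord0 = [set v | eccentricity v == 1%E] by rewrite /P unlift_none.
have PS j : P (lift ord0 j) = [set v | class_rep v == enum_val j] by rewrite /P liftK.
have split_ord (i : 'I_#|D|.+1) : i = ord0 \/ exists j, i = lift ord0 j.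
  by case: (unliftP ord0 i) => [j ->|->]; [right; exists j|left].
have ecc_rep v : eccentricity v != 1%E -> eccentricity (class_rep v) != 1%E.
  apply: contra => /[dup] e /eccentricity1[_ vE].
  have [-> //|/vE] := eqVneq v (class_rep v).
  by rewrite edge_sym (negPf (class_rep_nonedge v)).
have PSN1 (j : 'I_#|D|) v : class_rep v == enum_val j -> eccentricity v != 1%E.
  move=> /eqP vj; have := valD j; rewrite DP -vj => /andP[+ _].
  apply: contra => /[dup] e /eccentricity1[_ vE].
  have [-> //|/vE] := eqVneq (class_rep v) v.
  by rewrite (negPf (class_rep_nonedge v)).
exists #|D|, P; split=> //.
- split=> [|i j|i].
  + apply/setP => v; rewrite inE; apply/bigcupP.
    have [e|e] := boolP (eccentricity v == 1%E).
      by exists ord0 => //; rewrite P0 inE.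
    have vD : class_rep v \in D by rewrite DP ecc_rep // class_repK eqxx.
    exists (lift ord0 (enum_rank_in vD (class_rep v))) => //.
    by rewrite PS inE enum_rankK_in.
  + move=> ij; rewrite -setI_eq0; apply/eqP/setP => v; rewrite !inE.
    apply/negP => /andP[].
    case: (split_ord i) (split_ord j) ij => [->|[k ->]] [->|[l ->]]; rewrite ?P0 ?PS ?inE ?eqxx //.
    * by move=> _ h /PSN1; rewrite h.
    * by move=> _ /PSN1/negPf ->.
    * move=> kl /eqP -> /eqP /enum_val_inj e.
      by rewrite e eqxx in kl.
  + case: (split_ord i) => [->|[j ->]]; first by rewrite eqxx.
    move=> _; apply/set0Pn; exists (enum_val j); rewrite PS inE.
    by have := valD j; rewrite DP => /andP[].
- move=> k u v; case: (split_ord k) => [->|[j ->]]; first by rewrite eqxx.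
  by move=> _; rewrite PS !inE -class_repP => /eqP -> /eqP ->.
move=> i j u v ij ui vj.
have uv : u != v.
  apply/eqP => e; rewrite {}e in ui; move: ij ui vj.
  case: (split_ord i) (split_ord j) => [->|[k ->]] [->|[l ->]]; rewrite ?P0 ?PS ?inE ?eqxx //.
  * by move=> _ h /PSN1; rewrite h.
  * by move=> _ /PSN1/negPf ->.
  * by move=> kl /eqP -> /eqP /enum_val_inj e; rewrite e eqxx in kl.
move: ij ui vj; case: (split_ord i) (split_ord j) => [->|[k ->]] [->|[l ->]]; rewrite ?P0 ?PS ?inE ?eqxx //.
- by move=> _ /eccentricity1[_ uE] _; apply: uE; rewrite eq_sym.
- by move=> _ _ /eccentricity1[_ vE]; rewrite edge_sym vE.
- move=> kl /eqP ek /eqP el; apply: contraNT kl; rewrite -class_repP ek el.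
  by move=> /eqP /enum_val_inj ->.
Qed.

End Eccentricity.

Local Open Scope group_scope.

Lemma prodgM_commute_uniq (G : groupType) (I : eqType) (r : seq I) (F H : I -> G) :
  uniq r -> (forall i j, i != j -> commute (F i) (H j)) ->
  \prod_(i <- r) (F i * H i) = \prod_(i <- r) F i * \prod_(i <- r) H i.
Proof.
move=> + FH; elim: r => [|i r IHr] /=; first by rewrite !big_nil mulg1.
move=> /andP[ir /IHr {}IHr]; rewrite !big_cons IHr !mulgA; congr (_ * _).
rewrite -!mulgA; congr (_ * _); rewrite big_seq; apply: commute_prod => j jr.
by apply/commute_sym/FH; apply: contraNneq ir => <-.
Qed.

Lemma is_free_free_group (X : choiceType) : is_free (free_group X).
Proof. by exists X; exists (idfun : {multiplicative _ -> _}); exists idfun. Qed.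

Lemma free_group_finType_fg (X : finType) : finitely_generated (free_group X).
Proof.
exists [seq generator _ x | x : X] => S genS; apply: presented_ind.
- exact: gpred1.
- by move=> x g gS; apply: gpredM gS; apply/genS/map_f; rewrite mem_enum.
- by move=> x g gS; apply: gpredM gS; apply/gpredVr/genS/map_f; rewrite mem_enum.
Qed.

Lemma free_group_hom (X : choiceType) (H : groupType) (f : X -> H) :
  exists phi : {multiplicative free_group X -> H}, forall x, phi (generator _ x) = f x.
Proof. by apply: presented_hom. Qed.

(** * The graph group as a product of free groups *)

Section Product.
Variable Gamma : sgraph.
Hypothesis NT : nonedge_transitive Gamma.
Implicit Types u v : Gamma.

(* The block of the [i]-th vertex if that vertex represents it, empty otherwise. *)
Definition block (i : 'I_#|Gamma|) : finType := {v : Gamma | class_rep v == enum_val i}.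

Definition block_group (i : 'I_#|Gamma|) : groupType := free_group (block i).

Let coordinate v i : block_group i :=
  if (insub v : option (block i)) is Some w then generator _ w else 1.

(** The inverse map multiplies the images of the coordinates in the graph group. It is a
    homomorphism because vertices of distinct classes are adjacent, so that the images of distinct
    blocks commute. *)
Lemma graph_group_product : isomorphic (graph_group Gamma) (direct_product block_group).
Proof.
have [u v uv|fwd fwdE] := @graph_group_hom Gamma (direct_product block_group)
    (fun v i => coordinate v i).
  apply: functional_extensionality_dep => i; rewrite /coordinate.
  change (commute (coordinate u i) (coordinate v i)); rewrite /coordinate.
  case: insubP => [u' /eqP ui _|_]; last exact/commute_sym/commute1.
  case: insubP => [v' /eqP vi _|_]; last exact/commute1.
  by have := class_repP NT u v; rewrite ui vi eqxx uv.
have iotaP i : exists f : {multiplicative block_group i -> graph_group Gamma},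
  forall w, f (generator _ w) = vgen (val w) by apply: free_group_hom.
pose iota i := projT1 (cid (iotaP i)).
have iotaE i w : iota i (generator _ w) = vgen (val w) by rewrite /iota; case: cid.
have iotaC i j g h : i != j -> commute (iota i g) (iota j h).
  move=> ij; have vC u v : class_rep u = enum_val i -> class_rep v = enum_val j ->
      commute (vgen u) (vgen v).
    move=> ui vj; apply: vgen_commute; apply: contraNT ij.
    by rewrite -class_repP // ui vj => /eqP /enum_val_inj ->.
  have wC u : class_rep u = enum_val i -> commute (vgen u) (iota j h).
    move=> ui; elim/presented_ind: h => [|w h IHh|w h IHh].
    - by rewrite hom1; apply: commute1.
    - rewrite gmulfM iotaE; apply: commuteM IHh.
      by apply: vC => //; apply/eqP/(valP w).
    - rewrite gmulfM homV iotaE; apply: commuteM IHh; apply: commuteV.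
      by apply: vC => //; apply/eqP/(valP w).
  apply: commute_sym; elim/presented_ind: g => [|w g IHg|w g IHg].
  - by rewrite hom1; apply: commute1.
  - rewrite gmulfM iotaE; apply: commuteM IHg; apply: commute_sym.
    by apply: wC; apply/eqP/(valP w).
  - rewrite gmulfM homV iotaE; apply: commuteM IHg; apply/commuteV/commute_sym.
    by apply: wC; apply/eqP/(valP w).
pose psi (f : direct_product block_group) := \prod_i iota i (f i).
have psiM : {morph psi : f g / f * g}.
  move=> f g; rewrite /psi -prodgM_commute_uniq ?index_enum_uniq //.
    by apply: eq_bigr => i _; rewrite -gmulfM.
  by move=> i j; apply: iotaC.
pose mpsi := isMultiplicative.Build _ _ psi psiM.
pose psi' : {multiplicative direct_product block_group -> graph_group Gamma} := HB.pack psi mpsi.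
exists fwd; exists psi => [x|f].
  have e : (psi' \o fwd : {multiplicative _ -> _}) =1 (idfun : {multiplicative _ -> _}).
    apply: presented_hom_eq => v /=; rewrite fwdE /psi.
    rewrite (big_only1 (enum_rank (class_rep v))) // => [|j jv _].
      rewrite /coordinate insubT /=; first by rewrite enum_rankK.
      by move=> vi; rewrite iotaE.
    rewrite /coordinate insubF ?hom1 //; apply: contraNF jv => /eqP ->.
    by rewrite enum_valK.
  exact: e.
have coordM k : {morph (fun g : direct_product block_group => g k) : g h / g * h} by [].
apply: functional_extensionality_dep => j.
(* Both composites of block maps at once: the identity if [i = j] and trivial otherwise; [ecast]
   transports along [i = j]. *)
have fwd_iota i g : fwd (iota i g) j = if i =P j is ReflectT e then
    ecast i (block_group i) e g else 1.
  case: eqP => [e|ij].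
    case: j / e => /=; elim/presented_ind: g => [|w g IHg|w g IHg].
    - by rewrite !hom1.
    - by rewrite !gmulfM coordM IHg iotaE fwdE /coordinate valK.
    - rewrite !gmulfM coordM IHg homV iotaE homV.
      change ((fwd (vgen (val w)) i)^-1 * g = (generator _ w)^-1 * g).
      by rewrite fwdE /coordinate valK.
  elim/presented_ind: g => [|w g IHg|w g IHg].
  - by rewrite !hom1.
  - rewrite !gmulfM coordM IHg iotaE fwdE mulg1 /coordinate insubF //.
    by apply/negP => /eqP h; apply: ij; apply: enum_val_inj; rewrite -h; apply/esym/eqP/(valP w).
  - rewrite !gmulfM coordM IHg homV iotaE homV mulg1.
    change ((fwd (vgen (val w)) j)^-1 = 1).
    rewrite fwdE /coordinate insubF ?invg1 //.
    by apply/negP => /eqP h; apply: ij; apply: enum_val_inj; rewrite -h; apply/esym/eqP/(valP w).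
have -> : fwd (psi f) j = \prod_i fwd (iota i (f i)) j.
  rewrite /psi; elim/big_rec2: _ => [|i y1 y2 _ IH]; first by rewrite hom1.
  by rewrite gmulfM coordM IH.
rewrite (big_only1 j) // => [|i ij _]; rewrite fwd_iota; case: eqP => //.
  by move=> e; rewrite (eq_axiomK e).
by move=> e; rewrite e eqxx in ij.
Qed.

Lemma graph_group_free_product : exists (k : nat) (F : 'I_k -> groupType),
  (forall i, is_free (F i) /\ finitely_generated (F i)) /\
  isomorphic (graph_group Gamma) (direct_product F).
Proof.
exists #|Gamma|, block_group; split; last exact: graph_group_product.
by move=> i; split; [apply: is_free_free_group|apply: free_group_finType_fg].
Qed.

End Product.

Local Close Scope group_scope.

(** * Free groups and their products inside V *)

Section Codes.
Implicit Types (z : cantor_space) (u v w : seq bool) (C D : seq (seq bool)).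

Lemma size_words n : size (words n) = 2 ^ n.
Proof. by rewrite /words size_map -cardE card_tuple card_bool. Qed.

Lemma complete_extend C D u : complete_prefix_code C -> complete_prefix_code D -> u \in C ->
  complete_prefix_code (rem u C ++ [seq u ++ d | d <- D]).
Proof.
move=> cC cD uC z; rewrite count_cat count_rem uC cC count_map.
case: (boolP (is_prefix u z)) => [/is_prefixP[z' ->]|uz] /=.
  rewrite subnn add0n -[RHS](cD z'); apply: eq_count => d /=.
  exact: is_prefix_cat.
rewrite subn0 (@eq_count _ _ pred0) ?count_pred0 // => d /=.
by apply/negbTE; apply: contra uz; apply: is_prefix_catW.
Qed.

(** Splitting one word into its two one-letter extensions enlarges a complete code by one. *)
Lemma complete_code_size n : exists2 D, complete_prefix_code D & size D = n.+1.
Proof.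
elim: n => [|n [D cD sD]]; first by exists (words 0); [apply: words_complete|rewrite size_words].
case: D cD sD => // u D cD sD.
exists (rem u (u :: D) ++ [seq u ++ d | d <- words 1]).
  by apply: complete_extend; rewrite ?mem_head //; apply: words_complete.
by rewrite size_cat size_map size_words /= eqxx addn2; case: sD => ->.
Qed.

Lemma complete_unique (t : seq (seq bool * seq bool)) z p q :
  complete_prefix_code (unzip1 t) -> p \in t -> q \in t ->
  is_prefix p.1 z -> is_prefix q.1 z -> p = q.
Proof.
move=> /(_ z); rewrite count_map -size_filter => s1 pt qt pz qz.
have : p \in [seq x <- t | is_prefix x.1 z] by rewrite mem_filter pz.
have : q \in [seq x <- t | is_prefix x.1 z] by rewrite mem_filter qz.
by case: [seq x <- t | _] s1 => [|r []] //= _; rewrite !inE => /eqP -> /eqP ->.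
Qed.

Lemma table_function (t : seq (seq bool * seq bool)) : complete_prefix_code (unzip1 t) ->
  exists f : cantor_space -> cantor_space, forall u w, (u, w) \in t -> cone_map f u w.
Proof.
move=> ct.
have /choice[f fP] (z : cantor_space) : exists y : cantor_space, exists p z',
    [/\ p \in t, z = prepend p.1 z' & y = prepend p.2 z'].
  have : has (is_prefix^~ z) (unzip1 t) by rewrite has_count ct.
  by case/hasP=> _ /mapP[p pt ->] /is_prefixP[z' e]; exists (prepend p.2 z'), p, z'.
exists f => u w uwt z; have [[u' w'] [z' [pt /= e ->]]] := fP (prepend u z).
have [uE wE] : (u', w') = (u, w).
  by apply: (@complete_unique _ (prepend u z) _ _ ct) => //; apply/is_prefixP; [exists z'|exists z].
by rewrite uE in e; rewrite wE (prepend_inj e).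
Qed.

Lemma table_V (t : seq (seq bool * seq bool)) :
  complete_prefix_code (unzip1 t) -> complete_prefix_code (unzip2 t) ->
  exists f : thompson_V, forall u w, (u, w) \in t -> cone_map (val f) u w.
Proof.
move=> c1 c2; have [f fP] := table_function c1.
pose t' := [seq (p.2, p.1) | p <- t].
have [|g gP] := @table_function t'; first by rewrite /unzip1 -map_comp.
have cancel_table h h' (s : seq (seq bool * seq bool)) : complete_prefix_code (unzip1 s) ->
    (forall u w, (u, w) \in s -> cone_map h u w) ->
    (forall u w, (u, w) \in s -> cone_map h' w u) -> cancel h h'.
  move=> cs hP h'P z; have : has (is_prefix^~ z) (unzip1 s) by rewrite has_count cs.
  case/hasP=> _ /mapP[[u w] uws ->] /is_prefixP[z' ->].
  by rewrite (hP _ _ uws) (h'P _ _ uws).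
have fK : cancel f g.
  by apply: (cancel_table _ _ _ c1 fP) => u w uwt; apply: gP; apply/mapP; exists (u, w).
have gK : cancel g f.
  apply: (cancel_table _ _ t' _ gP); first by rewrite /unzip1 -map_comp.
  by move=> u w /mapP[[u' w'] uwt [-> ->]]; apply: fP.
have [L fL] : exists L, forall u, size u = L -> exists w, cone_map f u w.
  by apply: prefix_replacement_cone; exists t.
by exists (exist _ f (asboolT (in_V fK gK fL))).
Qed.

Lemma mem_zip_pair (S T : eqType) (s : seq S) (t : seq T) x y :
  (x, y) \in zip s t -> x \in s /\ y \in t.
Proof.
elim: s t => [|a s IHs] [|b t] //=; rewrite !inE xpair_eqE.
by move=> /orP[/andP[-> ->]//|/IHs[-> ->]]; rewrite !orbT.
Qed.

(** A code [D] with one word fewer than [words n] cuts the cones [u] and [v] into pieces. The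
    element maps the cones other than [u] to the pieces of [v], and the pieces of [u] to the cones
    other than [v]. *)
Lemma ping_pong_element n u v : u \in words n -> v \in words n -> u != v ->
  exists f : thompson_V,
    (forall z, mkseq z n != u -> mkseq (val f z) n = v) /\
    (forall z, mkseq z n != v -> mkseq (val f^-1%g z) n = u).
Proof.
move=> uC vC uv; set C := words n in uC vC.
have sC : (size C).-1 = (size C).-2.+1.
  have : size [:: u; v] <= size C.
    apply: uniq_leq_size; first by rewrite /= inE uv.
    by move=> w; rewrite !inE => /orP[]/eqP->.
  by case: (size C) => [|[]].
have [D cD sD] := complete_code_size (size C).-2.
have cC : complete_prefix_code C by apply: words_complete.
have sE x : x \in C -> size (rem x C) = size D by move=> xC; rewrite size_rem // sC sD.
pose t := zip (rem u C) [seq v ++ d | d <- D] ++ zip [seq u ++ d | d <- D] (rem v C).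
have z1 : unzip1 t = rem u C ++ [seq u ++ d | d <- D].
  by rewrite /unzip1 map_cat -!/(unzip1 _) !unzip1_zip // ?size_map ?sE.
have z2 : unzip2 t = [seq v ++ d | d <- D] ++ rem v C.
  by rewrite /unzip2 map_cat -!/(unzip2 _) !unzip2_zip // ?size_map ?sE.
have [||f fP] := @table_V t.
- by rewrite z1; apply: complete_extend.
- by move=> z; rewrite z2 count_cat addnC -count_cat; apply: complete_extend.
have sw x : x \in C -> size x = n by rewrite mem_words => /eqP.
have su := sw u uC; have sv := sw v vC.
exists f; split=> z zN.
  have : mkseq z n \in unzip1 (zip (rem u C) [seq v ++ d | d <- D]).
    by rewrite unzip1_zip ?size_map ?sE // mem_rem_uniq ?words_uniq // inE zN mem_words size_mkseq /=.
  case/mapP => [[x y] xyt /= e]; have [_ /mapP[d _ yE]] := mem_zip_pair xyt.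
  rewrite -(mkseq_shift n z) e (fP x y) ?mem_cat ?xyt //.
  by rewrite yE prependA -sv mkseq_prepend.
have : mkseq z n \in unzip2 (zip [seq u ++ d | d <- D] (rem v C)).
  by rewrite unzip2_zip ?size_map ?sE // mem_rem_uniq ?words_uniq // inE zN mem_words size_mkseq /=.
case/mapP => [[x y] xyt /= e]; have [/mapP[d _ xE] _] := mem_zip_pair xyt.
rewrite -(mkseq_shift n z) e -(fP x y) ?mem_cat ?xyt ?orbT // val_VK.
by rewrite xE prependA -su mkseq_prepend.
Qed.

End Codes.

Local Open Scope group_scope.

Section PingPong.
Variables (X : choiceType) (G : groupType) (phi : {multiplicative free_group X -> G}).
Variables (Y Z : Type) (act : G -> Y -> Y) (color : Y -> Z) (W : X * bool -> Z) (y0 : Y).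
Hypothesis act1 : forall y, act 1 y = y.
Hypothesis actM : forall g h y, act (g * h) y = act g (act h y).
Hypothesis W_inj : injective W.
Hypothesis y0_color : forall a, color y0 <> W a.

Let letter (a : X * bool) : free_group X := if a.2 then generator _ a.1 else (generator _ a.1)^-1.
Let opp (a : X * bool) := (a.1, ~~ a.2).

Hypothesis attracts : forall a y, color y <> W (opp a) -> color (act (phi (letter a)) y) = W a.

Fixpoint reduced_word (w : seq (X * bool)) : bool :=
  if w is a :: w' then (if w' is b :: _ then b != opp a else true) && reduced_word w' else true.

Lemma letter_opp a : letter (opp a) = (letter a)^-1.
Proof. by case: a => x [] //=; rewrite /letter /= invgK. Qed.

Lemma reduced_word_exists g : exists2 w, reduced_word w & g = \prod_(a <- w) letter a.
Proof.
have step a h : (exists2 w, reduced_word w & h = \prod_(b <- w) letter b) ->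
    exists2 w, reduced_word w & letter a * h = \prod_(b <- w) letter b.
  move=> [[|b w] rw ->]; first by exists [:: a]; rewrite ?big_seq1 ?big_nil ?mulg1.
  have [->|ba] := eqVneq b (opp a); last by exists [:: a, b & w]; rewrite ?[RHS]big_cons //= ba.
  exists w; first by case/andP: rw.
  by rewrite big_cons letter_opp mulgA mulgV mul1g.
elim/presented_ind: g => [|x g IHg|x g IHg]; first by exists [::]; rewrite ?big_nil.
  exact: (step (x, true)).
exact: (step (x, false)).
Qed.

Lemma ping_pong_word a w : reduced_word (a :: w) ->
  color (act (phi (\prod_(b <- a :: w) letter b)) y0) = W a.
Proof.
elim: w a => [|b w IHw] a rw.
  by rewrite big_seq1; apply: attracts; apply: y0_color.
move: rw => /andP[ba rw]; rewrite big_cons gmulfM actM; apply: attracts.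
by rewrite IHw // => /W_inj/eqP; apply/negP.
Qed.

(** Colours replace disjoint attracting sets: a nonempty reduced word gives [y0] the colour of its
    first letter, which [y0] itself does not have. *)
Lemma ping_pong : injective phi.
Proof.
have phi1 g : phi g = 1 -> g = 1.
  have [[|a w] rw ->] := reduced_word_exists g; first by rewrite big_nil.
  move=> e; have := ping_pong_word rw; rewrite e act1 => /y0_color //.
move=> g h e; apply/divg1_eq/phi1.
by rewrite gmulfM homV e mulgV.
Qed.

End PingPong.

(** A generator [x] occurring in none of the words that represent the given elements would be
    detected by the homomorphism to Z that sends [x] to 1 and the other generators to 0: its kernel
    contains all given elements but not [x]. *)
Lemma fg_free_group_finite (X : choiceType) : finitely_generated (free_group X) ->
  exists s : seq X, forall x, x \in s.
Proof.
move=> [gs gsP].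
exists (flatten [seq [seq a.1 | a <- repr g] | g <- gs]) => x; apply: contrapT => xs.
have [f fE] := @free_group_hom X groupZ (fun y => if y == x then 1%R : int else 0%R : int).
pose ker : {pred free_group X} := fun g => f g == 1.
have kerM : {in ker &, forall g h, g * h \in ker}.
  by move=> g h /eqP fg /eqP fh; apply/eqP; rewrite gmulfM fg fh mulg1.
have ker1 : 1 \in ker by apply/eqP; rewrite hom1.
have kerV : {in ker, forall g, g^-1 \in ker}.
  by move=> g /eqP fg; apply/eqP; rewrite homV fg invg1.
pose S : groupClosed (free_group X) := HB.pack ker
  (isMulClosed.Build _ ker kerM) (isMul1Closed.Build _ ker ker1) (isInvClosed.Build _ ker kerV).
have : generator _ x \in S.
  apply: gsP => g ggs; have {}ggs : {subset [seq a.1 | a <- repr g] <= predC1 x}.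
    move=> y yg; apply/eqP => e; apply: xs; rewrite -e; apply/flatten_mapP; by exists g.
  rewrite -[g]pres_class_repr; elim: (repr g) ggs => [|[y b] w IHw] h; first exact: gpred1.
  rewrite -[_ :: _]/([:: (y, b)] ++ w) pres_class_cat; apply: gpredM.
    have yx : y != x by apply: h; rewrite mem_head.
    have yS : generator _ y \in S by apply/eqP; rewrite fE (negPf yx).
    by case: b {h} => //; rewrite -generatorV; apply: gpredVr.
  by apply: IHw => z zw; apply: h; rewrite inE zw orbT.
by move/eqP; rewrite fE eqxx.
Qed.

Lemma free_group_in_V (X : choiceType) (s : seq X) : (forall x, x \in s) ->
  embeds (free_group X) thompson_V.
Proof.
(* Each generator needs two words of length [n], for itself and its inverse, and one more word, at
   index [(size s).*2], houses the base point. *)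
move=> sX; pose n := (size s).*2.+1.
have n_lt : n < size (words n) by rewrite size_words ltn_expl.
pose W (a : X * bool) := nth [::] (words n) ((index a.1 s).*2 + a.2).
have idx (a : X * bool) : (index a.1 s).*2 + a.2 < (size s).*2.
  have : (index a.1 s).+1.*2 <= (size s).*2 by rewrite leq_double index_mem.
  by rewrite doubleS; apply: leq_trans; case: a => x []; rewrite /= ?addn1 ?addn0 ?ltnS ?leqnSn ?leqnn.
have idx' (a : X * bool) : (index a.1 s).*2 + a.2 < size (words n).
  by apply: leq_trans (ltnW n_lt); apply: leqW.
have Wwords a : W a \in words n by apply: mem_nth.
have W_inj : injective W.
  move=> [x b] [y c] /eqP; rewrite nth_uniq ?words_uniq // => /eqP /= e.
  have bc : b = c by have := congr1 odd e; rewrite !oddD !odd_double !oddb.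
  move: e; rewrite bc => /addIn /double_inj ixy; congr (_, _).
  by rewrite -(nth_index x (sX x)) ixy nth_index.
have /choice[g gP] x : exists f : thompson_V,
    (forall z, mkseq z n != W (x, false) -> mkseq (val f z) n = W (x, true)) /\
    (forall z, mkseq z n != W (x, true) -> mkseq (val f^-1 z) n = W (x, false)).
  by apply: ping_pong_element => //; apply/eqP => /W_inj.
have [phi phiE] := @free_group_hom X thompson_V g.
exists phi.
pose w0 := nth [::] (words n) (size s).*2.
have w0P : size w0 = n by apply/eqP; rewrite -mem_words mem_nth // (leq_trans _ (ltnW n_lt)).
pose y0 : cantor_space := prepend w0 (fun=> false).
apply: (@ping_pong X thompson_V phi cantor_space (seq bool) (fun f => val f)
  (fun z => mkseq z n) W y0) => //.
- move=> a; rewrite /y0 -{1}w0P mkseq_prepend => /eqP.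
  rewrite nth_uniq ?words_uniq //; last exact: leq_trans (ltnW n_lt).
  by move=> /eqP e; have := idx a; rewrite -e ltnn.
move=> [x b] z /eqP; have [g1 g2] := gP x.
by case: b => /=; rewrite ?homV phiE => h; [apply: g1|apply: g2].
Qed.

Section Power.
Variable k : nat.
Implicit Types (f g : 'I_k -> thompson_V) (z : cantor_space).

Let slot z : option 'I_k := insub (index (mkseq z k) (words k)).

(** There are more than [k] words of length [k]: the cone of the [i]-th one carries the [i]-th copy
    of V, and the surplus cones are fixed pointwise. *)
Definition blockwise f z : cantor_space :=
  if slot z is Some i then prepend (mkseq z k) (val (f i) (shift k z)) else z.

Lemma mkseq_blockwise f z : mkseq (blockwise f z) k = mkseq z k.
Proof.
rewrite /blockwise; case: (slot z) => // i.
by rewrite mkseq_prepend_size ?size_mkseq.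
Qed.

Lemma blockwiseM f g z : blockwise (fun i => f i * g i) z = blockwise f (blockwise g z).
Proof.
rewrite [in RHS]/blockwise /slot mkseq_blockwise -/(slot z).
rewrite /blockwise; case: (slot z) => // i.
by rewrite shift_prepend_size ?size_mkseq // val_VM.
Qed.

Lemma blockwise1 f z : (forall i, f i = 1) -> blockwise f z = z.
Proof.
by move=> f1; rewrite /blockwise; case: (slot z) => // i; rewrite f1 val_V1 mkseq_shift.
Qed.

Lemma blockwise_in_V f : homeomorphism (blockwise f) /\ prefix_replacement (blockwise f).
Proof.
have /choice[L LP] i := V_cone (f i).
apply: (@in_V _ (blockwise (fun i => (f i)^-1)) (k + \max_i L i)%N).
- by move=> z; rewrite -blockwiseM blockwise1 // => i; rewrite mulVg.
- by move=> z; rewrite -blockwiseM blockwise1 // => i; rewrite mulgV.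
move=> u uL; pose v := take k u; pose w := drop k u.
have vk : size v = k by rewrite size_takel // uL leq_addr.
have uE z : prepend u z = prepend v (prepend w z) by rewrite -prependA cat_take_drop.
have slotE z : slot (prepend u z) = insub (index v (words k)).
  by rewrite /slot uE mkseq_prepend_size.
rewrite /cone_map /blockwise.
case E: (insub (index v (words k)) : option 'I_k) => [i|]; last first.
  by exists u => z; rewrite slotE E.
have [|w' w'P] := @cone_map_long _ _ (LP i) w.
  by rewrite size_drop uL addKn leq_bigmax.
exists (v ++ w') => z; rewrite slotE E prependA uE mkseq_prepend_size // shift_prepend_size //.
by rewrite w'P.
Qed.

Lemma direct_product_in_V (F : 'I_k -> groupType) :
  (forall i, embeds (F i) thompson_V) -> embeds (direct_product F) thompson_V.
Proof.
move=> FV; have eP i : exists e : {multiplicative F i -> thompson_V}, injective e by apply: FV.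
pose e i := projT1 (cid (eP i)); have e_inj i : injective (e i) by rewrite /e; case: cid.
pose Phi (f : direct_product F) : thompson_V :=
  exist _ (blockwise (fun i => e i (f i))) (asboolT (blockwise_in_V _)).
have PhiM : {morph Phi : f g / f * g}.
  move=> f g; apply: V_ext => z; rewrite val_VM /= -blockwiseM.
  by congr (blockwise _ z); apply: functional_extensionality_dep => i; rewrite -gmulfM.
pose mPhi := isMultiplicative.Build _ _ Phi PhiM.
pose Phi' : {multiplicative direct_product F -> thompson_V} := HB.pack Phi mPhi.
exists Phi' => f g fg; apply: functional_extensionality_dep => i; apply: (@e_inj i).
have ik : i < size (words k) by rewrite size_words (ltn_trans (ltn_ord i)) // ltn_expl.
pose w := nth [::] (words k) i; have wk : size w = k by apply/eqP; rewrite -mem_words mem_nth.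
have blockE h z : blockwise h (prepend w z) = prepend w (val (h i) z).
  rewrite /blockwise /slot mkseq_prepend_size // shift_prepend_size // index_uniq ?words_uniq //.
  by rewrite valK.
apply: V_ext => z; apply: (@prepend_inj w).
by have := congr1 (fun h : thompson_V => val h (prepend w z)) fg; rewrite /= !blockE.
Qed.

End Power.

Local Close Scope group_scope.

Lemma free_in_V (G : groupType) : is_free G -> finitely_generated G -> embeds G thompson_V.
Proof.
move=> [X /[dup] GX [f [g fK gK]]] [gs gsP]; apply: embeds_trans (isomorphic_embeds GX) _.
have [s sX] : exists s : seq X, forall x, x \in s; last exact: free_group_in_V sX.
apply: fg_free_group_finite; exists [seq f x | x <- gs] => S fS y.
pose T : {pred G} := fun x => f x \in S.
have TM : {in T &, forall x y, (x * y)%g \in T}.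
  by move=> a b aT bT; rewrite /T unfold_in gmulfM; apply: gpredM.
have T1 : 1%g \in T by rewrite /T unfold_in hom1; apply: gpred1.
have TV : {in T, forall x, (x^-1)%g \in T}.
  by move=> a aT; rewrite /T unfold_in homV; apply: gpredVr.
pose T' : groupClosed G := HB.pack T
  (isMulClosed.Build _ T TM) (isMul1Closed.Build _ T T1) (isInvClosed.Build _ T TV).
rewrite -(gK y); apply: (gsP T') => x xgs.
by apply: fS; apply: map_f.
Qed.

Theorem corollary6 :
  [/\ forall Gamma : sgraph,
        embeds (graph_group Gamma) thompson_V <-> GP Gamma,
      forall Gamma : sgraph,
        embeds (graph_group Gamma) thompson_V <->
        exists (k : nat) (F : 'I_k -> groupType),
          (forall i, is_free (F i) /\ finitely_generated (F i)) /\
          isomorphic (graph_group Gamma) (direct_product F) &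
      forall Gamma : sgraph,
        embeds (graph_group Gamma) thompson_V <->
        ~ has_subgroup_isomorphic_to (graph_group Gamma)
            (free_product (groupZ * groupZ)%type groupZ)].
Proof.
have product_V (Gamma : sgraph) : (exists (k : nat) (F : 'I_k -> groupType),
    (forall i, is_free (F i) /\ finitely_generated (F i)) /\
    isomorphic (graph_group Gamma) (direct_product F)) ->
    embeds (graph_group Gamma) thompson_V.
  move=> [k [F [Ffree GF]]]; apply: embeds_trans (isomorphic_embeds GF) _.
  by apply: direct_product_in_V => i; have [] := Ffree i; apply: free_in_V.
have V_nonedge (Gamma : sgraph) :
    embeds (graph_group Gamma) thompson_V <-> nonedge_transitive Gamma.
  split=> [GV|NT]; last exact/product_V/graph_group_free_product.
  apply: contrapT => /Z2Z_in_graph_group ZG.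
  exact: Z2Z_not_in_V (embeds_trans ZG GV).
split=> Gamma; rewrite V_nonedge.
- by split=> [/nonedge_transitive_GP|/GP_nonedge_transitive].
- by split=> [/graph_group_free_product|/product_V/V_nonedge].
split=> [/V_nonedge GV /embeds_subgroup ZG|noZ].
  exact: Z2Z_not_in_V (embeds_trans ZG GV).
by apply: contrapT => /Z2Z_in_graph_group /embeds_subgroup.
Qed.
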